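(* Let $L$ be a $G$-lattice. The following are equivalent: (a) $L$ is invertible; (b) the map $\varphi:L\otimes_{\mathbb{Z}\langle G\rangle}\bar L\to\mathbb{Z}\langle G\rangle$ defined by $\varphi(x\otimes\bar y)=x\cdot\bar y$ is an isomorphism of $\mathbb{Z}\langle G\rangle$-modules; (c) there is a $\mathbb{Z}\langle G\rangle$-module $M$ such that $L\otimes_{\mathbb{Z}\langle G\rangle}M$ and $\mathbb{Z}\langle G\rangle$ are isomorphic as $\mathbb{Z}\langle G\rangle$-modules, and as a lattice $L$ is unimodular; (d) $L$ is $G$-isomorphic to $L_{(I,w)}$ for some fractional $\mathbb{Z}\langle G\rangle$-ideal $I$ and some $w\in\mathbb{Q}\langle G\rangle^\ast$ such that $I\bar I=\mathbb{Z}\langle G\rangle\cdot w$ and $\psi(w)\in\mathbb{R}_{>0}$ for all $\psi\in\Psi$.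
   Context: Let $G$ be a finite abelian group with a fixed element $u$ of order $2$, $n=\#G/2$. A lattice is a finitely generated abelian group with a bilinear, symmetric, positive definite $\mathbb{Z}$-valued form $\langle\cdot,\cdot\rangle$; unimodular means Gram determinant $1$. A $G$-lattice is a lattice with a homomorphism from $G$ to its form-preserving automorphisms such that $u$ acts as $-1$; it is thereby a module over $\mathbb{Z}\langle G\rangle=\mathbb{Z}[G]/(u+1)$. For a commutative ring $A$, $A\langle G\rangle=A[G]/(u+1)$, $t(\sum a_\sigma\sigma)=a_1-a_u$, and $\overline{\sum a_\sigma\sigma}=\sum a_\sigma\sigma^{-1}$. A $G$-lattice $L$ is invertible if it has rank $n$, is unimodular, and for every $m\in\mathbb{Z}_{>0}$ there is $e_m\in L$ with $\{\sigma e_m+mL:\sigma\in G\}$ generating $L/mL$ as an abelian group. For a $G$-lattice $L$, $\bar L$ is a lattice with a lattice isomorphism $L\to\bar L$, $x\mapsto\bar x$, and $G$-action $\sigma\bar x=\overline{\sigma^{-1}x}$. Fix a set $S$ of coset representatives of $G/\langle u\rangle$; the lifted inner product is $x\cdot\bar y=\sum_{\sigma\in S}\langle x,\sigma y\rangle\sigma\in\mathbb{Z}\langle G\rangle$ for $x,y\in L$ (independent of $S$, $\mathbb{Z}\langle G\rangle$-bilinear). $\Psi$ is the set of ring homomorphisms $\mathbb{Q}\langle G\rangle\to\mathbb{C}$. A fractional $\mathbb{Z}\langle G\rangle$-ideal is a finitely generated $\mathbb{Z}\langle G\rangle$-submodule of $\mathbb{Q}\langle G\rangle$ spanning it over $\mathbb{Q}$.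 For such $I$ and $w$ as in (d), $L_{(I,w)}$ is the $G$-lattice $I$ with $G$ acting by multiplication and inner product $\langle x,y\rangle=t(x\bar y/w)$. A $G$-isomorphism is a form-preserving group isomorphism commuting with the $G$-actions. *)

(* Defs.v *)
From HB Require Import structures.
From mathcomp Require Import all_boot all_order all_algebra all_fingroup.
From mathcomp Require Import generic_quotient ring_quotient.
From mathcomp Require Import boolp classical_sets reals.
From mathcomp Require Import complex.
From mathcomp.multinomials Require freeg.

Set Implicit Arguments.
Unset Strict Implicit.
Unset Printing Implicit Defensive.

Import Order.TTheory GRing.Theory Num.Theory.
Local Open Scope ring_scope.
Local Open Scope quotient_scope.

(* Tensor product of two modules over a commutative ring: the free module on
   M * N modulo the submodule generated by the bilinearity relations. *)
Section Tensor.
Import freeg.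
Variables (R : comNzRingType) (M N : lmodType R).

Definition tens_free := {freeg (M * N)%type / R}.
HB.instance Definition _ := GRing.Lmodule.on tens_free.

Definition tens_gen (m : M) (n : N) : tens_free := Freeg [:: (1, (m, n))].

Inductive tens_rel : tens_free -> Prop :=
| tens_relDl m m' n :
    tens_rel (tens_gen (m + m') n - (tens_gen m n + tens_gen m' n))
| tens_relDr m n n' :
    tens_rel (tens_gen m (n + n') - (tens_gen m n + tens_gen m n'))
| tens_relZl a m n : tens_rel (tens_gen (a *: m) n - a *: tens_gen m n)
| tens_relZr a m n : tens_rel (tens_gen m (a *: n) - a *: tens_gen m n)
| tens_rel0 : tens_rel 0
| tens_relD x y : tens_rel x -> tens_rel y -> tens_rel (x + y)
| tens_relZ a x : tens_rel x -> tens_rel (a *: x).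

Definition tens_ker : {pred tens_free} := fun x => `[< tens_rel x >].

Lemma tens_ker_zmod : zmod_closed tens_ker.
Proof.
split=> [|x y /asboolP hx /asboolP hy]; apply/asboolP; first exact: tens_rel0.
by apply: tens_relD => //; rewrite -scaleN1r; apply: tens_relZ.
Qed.
HB.instance Definition _ :=
  GRing.isZmodClosed.Build tens_free tens_ker tens_ker_zmod.

Definition tensor := Quotient.quot tens_ker.
HB.instance Definition _ := GRing.Zmodule.on tensor.

Definition tens (m : M) (n : N) : tensor := \pi_tensor (tens_gen m n).

Definition tens_scale (a : R) (t : tensor) : tensor :=
  \pi_tensor (a *: repr t).

Lemma tens_piP (x y : tens_free) :
  reflect (tens_rel (x - y)) (\pi_tensor x == \pi_tensor y).
Proof. by rewrite -Quotient.idealrBE; apply: (iffP (asboolP _)). Qed.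

Lemma tens_piD x y : \pi_tensor (x + y) = \pi_tensor x + \pi_tensor y.
Proof. exact: raddfD. Qed.

Lemma tens_piZ a x : \pi_tensor (a *: x) = tens_scale a (\pi_tensor x).
Proof.
apply/eqP/tens_piP; rewrite -scalerBr; apply: tens_relZ.
by apply/tens_piP; rewrite reprK.
Qed.

Lemma tens_scaleA a b t : tens_scale a (tens_scale b t) = tens_scale (a * b) t.
Proof.
rewrite -[t]reprK -(tens_piZ b) -(tens_piZ a) -(tens_piZ (a * b)).
by rewrite scalerA.
Qed.

Lemma tens_scale1 : left_id 1 tens_scale.
Proof. by move=> t; rewrite -[t]reprK -tens_piZ scale1r. Qed.

Lemma tens_scaleDr : right_distributive tens_scale +%R.
Proof.
move=> a s t; rewrite -[s]reprK -[t]reprK -tens_piD -!tens_piZ.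
by rewrite -tens_piD scalerDr.
Qed.

Lemma tens_scaleDl t : {morph tens_scale^~ t : a b / a + b}.
Proof. by move=> a b; rewrite -[t]reprK -!tens_piZ -tens_piD scalerDl. Qed.

HB.instance Definition _ := GRing.Zmodule_isLmodule.Build R tensor
  tens_scaleA tens_scale1 tens_scaleDr tens_scaleDl.

Lemma tens_piZE a x : \pi_tensor (a *: x) = a *: (\pi_tensor x : tensor).
Proof. exact: tens_piZ. Qed.

Lemma tensDl m m' n : tens (m + m') n = tens m n + tens m' n.
Proof. by apply/eqP; rewrite -tens_piD; apply/tens_piP/tens_relDl. Qed.

Lemma tensDr m n n' : tens m (n + n') = tens m n + tens m n'.
Proof. by apply/eqP; rewrite -tens_piD; apply/tens_piP/tens_relDr. Qed.

Lemma tensZl a m n : tens (a *: m) n = a *: tens m n.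
Proof. by apply/eqP; rewrite -tens_piZE; apply/tens_piP/tens_relZl. Qed.

Lemma tensZr a m n : tens m (a *: n) = a *: tens m n.
Proof. by apply/eqP; rewrite -tens_piZE; apply/tens_piP/tens_relZr. Qed.

Lemma tens_freeE (x : tens_free) :
  x = \sum_(z <- dom x) coeff z x *: tens_gen z.1 z.2.
Proof.
rewrite -[LHS]freeg_sumE; apply: eq_bigr => z _; apply/eqP/freeg_eqP => y.
by rewrite coeffZ !coeffU -surjective_pairing mul1r.
Qed.

Lemma tensorE (t : tensor) : exists s : seq (R * (M * N)),
  t = \sum_(z <- s) z.1 *: tens z.2.1 z.2.2.
Proof.
exists [seq (coeff z (repr t), z) | z <- dom (repr t)].
rewrite big_map -[LHS]reprK {1}(tens_freeE (repr t)) raddf_sum /=.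
by apply: eq_bigr => z _; rewrite -tens_piZE.
Qed.

Lemma tensor_hom_ext (P : lmodType R) (f g : {linear tensor -> P}) :
  (forall m n, f (tens m n) = g (tens m n)) -> f =1 g.
Proof.
move=> fg t; have [s ->] := tensorE t; rewrite !linear_sum.
by apply: eq_bigr => z _; rewrite !linearZ fg.
Qed.

Section Lift.
Variables (P : lmodType R) (b : M -> N -> P).
Hypotheses (bDl : forall m m' n, b (m + m') n = b m n + b m' n)
  (bDr : forall m n n', b m (n + n') = b m n + b m n')
  (bZl : forall a m n, b (a *: m) n = a *: b m n)
  (bZr : forall a m n, b m (a *: n) = a *: b m n).

Let F (x : tens_free) : P := fglift (fun z => b z.1 z.2) x.

Let FB x y : F (x - y) = F x - F y.
Proof. by rewrite /F (lift_is_additive (fun z => b z.1 z.2)). Qed.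

Let F0 : F 0 = 0.
Proof. by rewrite -(subrr 0) FB subrr. Qed.

Let FD x y : F (x + y) = F x + F y.
Proof. by rewrite -{1}[y]opprK -[- y]sub0r !FB F0 sub0r opprK. Qed.

Let Fgen m n : F (tens_gen m n) = b m n.
Proof. by rewrite /F liftU scale1r. Qed.

Let FU c z : F (Freeg [:: (c, z)]) = c *: b z.1 z.2.
Proof. by rewrite /F liftU. Qed.

Let FZ a x : F (a *: x) = a *: F x.
Proof.
have Fsum I (r : seq I) (h : I -> tens_free) :
    F (\sum_(i <- r) h i) = \sum_(i <- r) F (h i).
  exact: (big_morph F FD F0).
rewrite -(freeg_sumE x) scaler_sumr !Fsum scaler_sumr; apply: eq_bigr => z _.
rewrite FU scalerA -FU; congr F; apply/eqP/freeg_eqP => y.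
by rewrite coeffZ !coeffU mulrA.
Qed.

Lemma tensor_lift :
  exists phi : {linear tensor -> P}, forall m n, phi (tens m n) = b m n.
Proof.
have Fker x : tens_rel x -> F x = 0.
  elim=> [m m' n|m n n'|a m n|a m n||y z _ hy _ hz|a y _ hy];
    rewrite ?F0 ?FB ?FD ?FZ ?Fgen ?bDl ?bDr ?bZl ?bZr ?subrr ?hy ?hz
      ?addr0 ?scaler0 //.
have Fpi x : F (repr (\pi_tensor x)) = F x.
  by apply/eqP; rewrite -subr_eq0 -FB Fker //; apply/tens_piP; rewrite reprK.
have lin : linear (fun t : tensor => F (repr t)).
  move=> a s t; rewrite -[s]reprK -[t]reprK -tens_piZE -tens_piD !Fpi.
  by rewrite FD FZ.
pose phiM := GRing.isLinear.Build R tensor P *:%R (fun t => F (repr t)) lin.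
pose phi : {linear tensor -> P} := HB.pack (fun t : tensor => F (repr t)) phiM.
by exists phi => m n; rewrite /phi /= Fpi Fgen.
Qed.

End Lift.
End Tensor.

Arguments tens {R M N}.

(* The group ring A[G] of an additively written finite abelian group G, under
   the convolution product. *)
Section GroupRing.
Variables (A : comNzRingType) (G : finZmodType).

Definition grpring : Type := {ffun G -> A}.
HB.instance Definition _ := GRing.Zmodule.on grpring.

Implicit Types x y z : grpring.

Definition gr_elt (s : G) : grpring := [ffun r => (r == s)%:R].
Definition gr_one : grpring := gr_elt 0.
Definition gr_mul x y : grpring := [ffun s => \sum_t x t * y (s - t)].

Lemma gr_mulC : commutative gr_mul.
Proof.
move=> x y; apply/ffunP => s; rewrite !ffunE.
rewrite (reindex_inj (can_inj (subKr s))) /=.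
by apply: eq_bigr => t _; rewrite subKr mulrC.
Qed.

Lemma gr_mulA : associative gr_mul.
Proof.
move=> x y z; apply/ffunP => s; rewrite !ffunE.
under eq_bigr do rewrite ffunE big_distrr /=.
under [RHS]eq_bigr do rewrite ffunE big_distrl /=.
rewrite [RHS]exchange_big /=; apply: eq_bigr => t _.
rewrite [RHS](reindex_inj (addIr t)) /=; apply: eq_bigr => r _.
by rewrite addrK mulrA opprD addrA [s - r - t]addrAC.
Qed.

Lemma gr_mul1 : left_id gr_one gr_mul.
Proof.
move=> x; apply/ffunP => s; rewrite ffunE (bigD1 0) //= !ffunE eqxx mul1r subr0.
by rewrite big1 ?addr0 // => t /negbTE t0; rewrite !ffunE t0 mul0r.
Qed.

Lemma gr_mulDl : left_distributive gr_mul +%R.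
Proof.
move=> x y z; apply/ffunP => s; rewrite !ffunE -big_split /=.
by apply: eq_bigr => t _; rewrite ffunE mulrDl.
Qed.

Lemma gr_one_neq0 : gr_one != 0.
Proof.
apply/eqP => /ffunP /(_ 0); rewrite !ffunE eqxx => /eqP.
by rewrite oner_eq0.
Qed.

HB.instance Definition _ := GRing.Zmodule_isComNzRing.Build grpring
  gr_mulA gr_mulC gr_mul1 gr_mulDl gr_one_neq0.

Lemma gr_mulE x y s : (x * y) s = \sum_t x t * y (s - t).
Proof. by rewrite ffunE. Qed.

Lemma gr_addE x y s : (x + y) s = x s + y s.
Proof. by rewrite ffunE. Qed.

Lemma gr_mul_elt x s r : (x * gr_elt s) r = x (r - s).
Proof.
rewrite gr_mulE (bigD1 (r - s)) //= ffunE subKr eqxx mulr1 big1 ?addr0 //.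
move=> t ts; rewrite ffunE [_ == s](_ : _ = false) ?mulr0 //.
by apply/negbTE; apply: contraNneq ts => <-; rewrite subKr.
Qed.

Definition gr_bar x : grpring := [ffun s => x (- s)].

End GroupRing.

(* A<G> = A[G]/(u + 1); the proof that u has order 2 is a parameter because it
   is what makes the ideal proper. *)
Section TwistedGroupRing.
Variables (A : comNzRingType) (G : finZmodType) (u : G) (hu : #[u]%g = 2%N).

Definition tw_ideal (_ : #[u]%g = 2%N) : {pred grpring A G} :=
  fun x => `[< exists y : grpring A G, x = y * (gr_elt A u + 1) >].

Lemma order2D : u + u = 0.
Proof. by have := expg_order u; rewrite hu. Qed.

Lemma order2N : - u = u.
Proof. by apply/eqP; rewrite eq_sym -subr_eq0 opprK order2D. Qed.

Lemma order2_neq0 : u != 0.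
Proof. by apply/eqP => u0; have := hu; rewrite u0 (order1 G). Qed.

Lemma tw_idealP (x : grpring A G) :
  x \in tw_ideal hu <-> exists y : grpring A G, x = y * (gr_elt A u + 1).
Proof. by split=> /asboolP. Qed.

Lemma tw_ideal_sym (x : grpring A G) :
  x \in tw_ideal hu -> forall s, x (s + u) = x s.
Proof.
move=> /tw_idealP[y ->] s; rewrite mulrDr mulr1 !gr_addE !gr_mul_elt addrK order2N.
by rewrite addrC.
Qed.

Lemma tw_ideal_closed : idealr_closed (tw_ideal hu).
Proof.
split; first by apply/tw_idealP; exists 0; rewrite mul0r.
- apply/negP => /tw_ideal_sym /(_ 0); rewrite add0r !ffunE eqxx.
  by rewrite (negbTE order2_neq0) => /esym /eqP; rewrite oner_eq0.
- move=> a x y /tw_idealP[x' ->] /tw_idealP[y' ->]; apply/tw_idealP.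
  by exists (a * x' + y'); rewrite mulrDl mulrA.
Qed.
HB.instance Definition _ :=
  isIdealr.Build (grpring A G) (tw_ideal hu) tw_ideal_closed.

Definition twring : Type := {ideal_quot (tw_ideal hu)}.
HB.instance Definition _ := GRing.ComNzRing.on twring.


Implicit Types x y : twring.

Definition tw_pi (x : grpring A G) : twring := \pi_twring x.

Lemma tw_piP (x y : grpring A G) :
  tw_pi x = tw_pi y <->
  exists z : grpring A G, x - y = z * (gr_elt A u + 1).
Proof.
split=> [/eqP|h]; first by rewrite -Quotient.idealrBE => /tw_idealP.
by apply/eqP; rewrite -Quotient.idealrBE; apply/tw_idealP.
Qed.

Lemma tw_reprK x : tw_pi (repr x) = x.
Proof. exact: reprK. Qed.

Lemma tw_piD (x y : grpring A G) : tw_pi (x + y) = tw_pi x + tw_pi y.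
Proof. exact: (raddfD \pi_({ideal_quot (tw_ideal hu)})). Qed.

Lemma tw_piB (x y : grpring A G) : tw_pi (x - y) = tw_pi x - tw_pi y.
Proof. exact: (raddfB \pi_({ideal_quot (tw_ideal hu)})). Qed.

Lemma tw_piM (x y : grpring A G) : tw_pi (x * y) = tw_pi x * tw_pi y.
Proof. exact: (rmorphM \pi_({ideal_quot (tw_ideal hu)})). Qed.

Lemma tw_pi1 : tw_pi 1 = 1.
Proof. exact: (rmorph1 \pi_({ideal_quot (tw_ideal hu)})). Qed.

HB.instance Definition _ :=
  GRing.isZmodMorphism.Build (grpring A G) twring tw_pi tw_piB.
HB.instance Definition _ :=
  GRing.isMonoidMorphism.Build (grpring A G) twring tw_pi (conj tw_pi1 tw_piM).

Definition tw_elt (s : G) : twring := tw_pi (gr_elt A s).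
Definition tw_const (a : A) : twring := tw_pi [ffun s => a *+ (s == 0)].

Definition tw_t x : A := (repr x : grpring A G) 0 - (repr x : grpring A G) u.
Definition tw_bar x : twring := tw_pi (gr_bar (repr x)).

Lemma tw_t_pi (x : grpring A G) : tw_t (tw_pi x) = x 0 - x u.
Proof.
have /tw_piP[z e] : tw_pi (repr (tw_pi x)) = tw_pi x by exact: tw_reprK.
have /tw_ideal_sym/(_ 0) : repr (tw_pi x) - x \in tw_ideal hu.
  by apply/tw_idealP; exists z.
rewrite add0r !ffunE /tw_t => /eqP; rewrite subr_eq => /eqP ->.
by rewrite opprD addrA subKr.
Qed.

Lemma gr_barM (x y : grpring A G) : gr_bar (x * y) = gr_bar x * gr_bar y.
Proof.
apply/ffunP => s; rewrite ffunE !gr_mulE (reindex_inj oppr_inj) /=.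
by apply: eq_bigr => t _; rewrite !ffunE opprB opprK addrC.
Qed.

Lemma gr_barB (x y : grpring A G) : gr_bar (x - y) = gr_bar x - gr_bar y.
Proof. by apply/ffunP => s; rewrite !ffunE. Qed.

Lemma gr_barD (x y : grpring A G) : gr_bar (x + y) = gr_bar x + gr_bar y.
Proof. by apply/ffunP => s; rewrite !ffunE. Qed.

Lemma gr_bar_elt (s : G) : gr_bar (gr_elt A s) = gr_elt A (- s).
Proof. by apply/ffunP => r; rewrite !ffunE eqr_oppLR. Qed.

Lemma tw_bar_pi (x : grpring A G) : tw_bar (tw_pi x) = tw_pi (gr_bar x).
Proof.
have /tw_piP[z e] : tw_pi (repr (tw_pi x)) = tw_pi x by exact: tw_reprK.
apply/tw_piP; exists (gr_bar z); rewrite -gr_barB e gr_barM gr_barD.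
by rewrite !gr_bar_elt order2N oppr0.
Qed.

Definition tw_unit : {pred twring} := fun x => `[< exists y, y * x = 1 >].
Definition tw_inv x : twring :=
  if pselect (exists y, y * x = 1) is left h then projT1 (cid h) else x.

Lemma tw_mulVx : {in tw_unit, left_inverse 1 tw_inv *%R}.
Proof.
move=> x /asboolP ux; rewrite /tw_inv; case: pselect => // h.
exact: (projT2 (cid h)).
Qed.

Lemma tw_unitPl x y : y * x = 1 -> x \in tw_unit.
Proof. by move=> yx; apply/asboolP; exists y. Qed.

Lemma tw_invr_out : {in [predC tw_unit], tw_inv =1 id}.
Proof.
move=> x; rewrite inE => /asboolPn nx; rewrite /tw_inv.
by case: pselect => // h; case: nx.
Qed.

HB.instance Definition _ := GRing.ComNzRing_hasMulInverse.Build twring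
  tw_mulVx tw_unitPl tw_invr_out.

End TwistedGroupRing.

Arguments tw_elt {A G u} hu s.
Arguments tw_const {A G u} hu a.

Section IntToRat.
Variables (G : finZmodType) (u : G) (hu : #[u]%g = 2%N).

Definition gr_ratr (x : grpring int G) : grpring rat G :=
  [ffun s => (x s)%:~R].

Definition tw_ratr (x : twring int hu) : twring rat hu :=
  tw_pi hu (gr_ratr (repr x)).

Lemma gr_ratrM x y : gr_ratr (x * y) = gr_ratr x * gr_ratr y.
Proof.
apply/ffunP => s; rewrite ffunE !gr_mulE rmorph_sum /=.
by apply: eq_bigr => t _; rewrite !ffunE rmorphM.
Qed.

Lemma gr_ratrB x y : gr_ratr (x - y) = gr_ratr x - gr_ratr y.
Proof. by apply/ffunP => s; rewrite !ffunE rmorphB. Qed.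

Lemma gr_ratrD x y : gr_ratr (x + y) = gr_ratr x + gr_ratr y.
Proof. by apply/ffunP => s; rewrite !ffunE rmorphD. Qed.

Lemma gr_ratr_elt (s : G) : gr_ratr (gr_elt int s) = gr_elt rat s.
Proof. by apply/ffunP => r; rewrite !ffunE; case: eqP. Qed.

Lemma tw_ratr_pi (x : grpring int G) :
  tw_ratr (tw_pi hu x) = tw_pi hu (gr_ratr x).
Proof.
have /tw_piP[z e] : tw_pi hu (repr (tw_pi hu x)) = tw_pi hu x.
  exact: tw_reprK.
apply/tw_piP; exists (gr_ratr z); rewrite -gr_ratrB e gr_ratrM gr_ratrD.
by rewrite !gr_ratr_elt.
Qed.

End IntToRat.

Record lattice := Lattice {
  lat_sort :> zmodType;
  lat_form : lat_sort -> lat_sort -> int;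
  lat_fg : exists (k : nat) (b : 'I_k -> lat_sort),
    forall x, exists c : 'I_k -> int, x = \sum_i b i *~ c i;
  lat_formDl : forall x y z,
    lat_form (x + y) z = lat_form x z + lat_form y z;
  lat_formC : forall x y, lat_form x y = lat_form y x;
  lat_form_gt0 : forall x, x != 0 -> 0 < lat_form x x
}.

Definition Zbasis (V : zmodType) (k : nat) (b : 'I_k -> V) : Prop :=
  forall x, exists! c : {ffun 'I_k -> int}, x = \sum_i b i *~ c i.

Definition has_rank (L : lattice) (k : nat) : Prop :=
  exists b : 'I_k -> L, Zbasis b.

Definition gram (L : lattice) (k : nat) (b : 'I_k -> L) : 'M[int]_k :=
  \matrix_(i, j) lat_form (b i) (b j).

Definition unimodular (L : lattice) : Prop :=
  exists (k : nat) (b : 'I_k -> L), Zbasis b /\ \det (gram b) = 1.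

Record glattice (G : finZmodType) (u : G) := GLattice {
  glat_lat :> lattice;
  gact : G -> glat_lat -> glat_lat;
  gact0 : forall x, gact 0 x = x;
  gactD : forall s t x, gact (s + t) x = gact s (gact t x);
  gact_add : forall s x y, gact s (x + y) = gact s x + gact s y;
  gact_form : forall s x y, lat_form (gact s x) (gact s y) = lat_form x y;
  gact_u : forall x, gact u x = - x
}.

(* Generation of L/mL by the cosets of the elements s e is written out in L. *)
Definition invertible (G : finZmodType) (u : G) (L : glattice u) : Prop :=
  [/\ has_rank L (#|G| %/ 2), unimodular L
    & forall m : nat, (0 < m)%N -> exists e : L,
        forall x : L, exists (c : G -> int) (y : L),
          x = \sum_s gact s e *~ c s + y *+ m].

Section GLattice.
Variables (G : finZmodType) (u : G) (hu : #[u]%g = 2%N).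

Section Bar.
Variable L : glattice u.

Definition bar_act (s : G) (x : L) : L := gact (- s) x.

Lemma bar_act0 x : bar_act 0 x = x.
Proof. by rewrite /bar_act oppr0 gact0. Qed.

Lemma bar_actD s t x : bar_act (s + t) x = bar_act s (bar_act t x).
Proof. by rewrite /bar_act opprD gactD. Qed.

Lemma bar_act_add s x y : bar_act s (x + y) = bar_act s x + bar_act s y.
Proof. exact: gact_add. Qed.

Lemma bar_act_form s x y :
  lat_form (bar_act s x) (bar_act s y) = lat_form x y.
Proof. exact: gact_form. Qed.

Lemma bar_act_u x : bar_act u x = - x.
Proof. by apply: oppr_inj; rewrite opprK -gact_u -gactD subrr gact0. Qed.

(* bar L has the same underlying lattice as L, and the isomorphism x |-> bar x
   is the identity map (bar_elt below). *)
Definition glat_bar : glattice u := @GLattice G u L bar_act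
  bar_act0 bar_actD bar_act_add bar_act_form bar_act_u.

End Bar.

(* The carrier of L, as the key for its Z<G>-module structure. *)
Definition gmod (_ : #[u]%g = 2%N) (L : glattice u) : Type := L.
HB.instance Definition _ (L : glattice u) := GRing.Zmodule.on (gmod hu L).

Section Module.
Variable L : glattice u.
Implicit Types (x y : L) (a b : grpring int G).

Definition gr_scale a x : L := \sum_s gact s x *~ a s.

Lemma gactB s x y : gact s (x - y) = gact s x - gact s y.
Proof.
have e : gact s (x - y) + gact s y = gact s x by rewrite -gact_add subrK.
by rewrite -e addrK.
Qed.

HB.instance Definition _ s := GRing.isZmodMorphism.Build L L (gact s) (gactB s).

Lemma gr_scaleB a b x : gr_scale (a - b) x = gr_scale a x - gr_scale b x.
Proof.
rewrite /gr_scale -sumrB; apply: eq_bigr => s _.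
by rewrite !ffunE mulrzBr.
Qed.

Lemma gr_scaleDl a b x : gr_scale (a + b) x = gr_scale a x + gr_scale b x.
Proof.
rewrite /gr_scale -big_split; apply: eq_bigr => s _.
by rewrite !ffunE mulrzDr.
Qed.

Lemma gr_scaleDr a x y : gr_scale a (x + y) = gr_scale a x + gr_scale a y.
Proof.
rewrite /gr_scale -big_split; apply: eq_bigr => s _.
by rewrite gact_add mulrzDl.
Qed.

Lemma gr_scale_elt s x : gr_scale (gr_elt int s) x = gact s x.
Proof.
rewrite /gr_scale (bigD1 s) //= ffunE eqxx big1 ?addr0 // => t /negbTE ts.
by rewrite ffunE ts.
Qed.

Lemma gr_scaleM a b x : gr_scale (a * b) x = gr_scale a (gr_scale b x).
Proof.
rewrite /gr_scale.
under eq_bigr do rewrite gr_mulE mulrz_sumr.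
rewrite exchange_big; apply: eq_bigr => s _ /=.
rewrite raddf_sum mulrz_suml (reindex_inj (addrI s)) /=; apply: eq_bigr => t _.
by rewrite addrAC subrr add0r gactD raddfMz mulrC mulrzA.
Qed.

Definition tw_scale (a : twring int hu) (x : gmod hu L) : gmod hu L :=
  gr_scale (repr a) x.

Lemma tw_scale_pi a (x : gmod hu L) : tw_scale (tw_pi hu a) x = gr_scale a x.
Proof.
have /tw_piP[z e] : tw_pi hu (repr (tw_pi hu a)) = tw_pi hu a.
  exact: tw_reprK.
apply/eqP; rewrite -subr_eq0 -gr_scaleB e gr_scaleM gr_scaleDl.
rewrite gr_scale_elt -[1]/(gr_elt int 0) gr_scale_elt gact0 gact_u addNr.
by rewrite /gr_scale big1 // => s _; rewrite raddf0 mul0rz.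
Qed.

Lemma tw_scaleA (a b : twring int hu) (x : gmod hu L) : tw_scale a (tw_scale b x) = tw_scale (a * b) x.
Proof.
by rewrite -[a]tw_reprK -[b]tw_reprK -tw_piM !tw_scale_pi gr_scaleM.
Qed.

Lemma tw_scale1 : left_id 1 tw_scale.
Proof.
move=> x; rewrite -(tw_pi1 int hu) tw_scale_pi.
by rewrite -[1]/(gr_elt int 0) gr_scale_elt gact0.
Qed.

Lemma tw_scaleDr : right_distributive tw_scale +%R.
Proof. by move=> a x y; apply: gr_scaleDr. Qed.

Lemma tw_scaleDl (x : gmod hu L) : {morph tw_scale^~ x : a b / a + b}.
Proof.
move=> a b /=; rewrite -[a]tw_reprK -[b]tw_reprK -tw_piD !tw_scale_pi.
exact: gr_scaleDl.
Qed.

HB.instance Definition _ := GRing.Zmodule_isLmodule.Build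
  (twring int hu) (gmod hu L) tw_scaleA tw_scale1 tw_scaleDr tw_scaleDl.

End Module.

Definition bar_elt (L : glattice u) (y : L) : gmod hu (glat_bar L) := y.

Definition coset_reps (S : {set G}) : bool :=
  is_transversal S (rcosets <[u]>%g [set: G]%SET) [set: G]%SET.

(* The lifted inner product x . bar y, an element of Z<G>. *)
Definition lip (S : {set G}) (L : glattice u) (x y : L) : twring int hu :=
  \sum_(s in S) tw_elt hu s *~ lat_form x (gact s y).

Section LiftedInnerProduct.
Variable L : glattice u.
Implicit Types (x y : L) (S T : {set G}).

Lemma coset_repsP S :
  coset_reps S -> forall s, (s + u \in S) = (s \notin S).
Proof.
case/and3P=> _ _ /forall_inP h s.
have /h/cards1P[x e] : (<[u]> :* s)%g \in rcosets <[u]>%g [set: G]%SET.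
  by apply/rcosetsP; exists s; rewrite ?inE.
have hm (y : G) : (y \in S) && ((y == s) || (y == s + u)) = (y == x).
  have /setP/(_ y) := e; rewrite !inE mem_rcoset cycle2g // !inE => <-.
  by rewrite -[(_ * _)%g]/(y - s) -[1%g]/(0 : G) subr_eq0 subr_eq [u + s]addrC.
have := hm s; have := hm (s + u); have := hm x.
rewrite !eqxx orbT !andbT => /andP[_ hx] -> ->.
have su : s + u != s by rewrite -subr_eq0 addrAC subrr add0r order2_neq0.
by case/orP: hx => /eqP->; rewrite eqxx ?(negbTE su) // eq_sym (negbTE su).
Qed.

Lemma sum_reps (V : zmodType) S T (F : G -> V) :
  (forall s, (s + u \in S) = (s \notin S)) ->
  (forall s, (s + u \in T) = (s \notin T)) ->
  (forall s, F (s + u) = F s) ->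
  \sum_(s in S) F s = \sum_(s in T) F s.
Proof.
move=> hS hT hF; rewrite (big_setID T) [RHS](big_setID S) /= finset.setIC.
congr (_ + _); rewrite (reindex_inj (addIr u)) /=.
by apply: eq_big => s; rewrite ?hF // !inE hS hT negbK andbC.
Qed.

Lemma gr_eltD (A : comNzRingType) (s t : G) :
  gr_elt A (s + t) = gr_elt A s * gr_elt A t.
Proof.
by apply/ffunP => r; rewrite gr_mul_elt !ffunE subr_eq.
Qed.

Lemma tw_eltD (A : comNzRingType) s t :
  tw_elt hu (s + t) = tw_elt hu s * tw_elt hu t :> twring A hu.
Proof. by rewrite /tw_elt gr_eltD tw_piM. Qed.

Lemma tw_elt_u (A : comNzRingType) : tw_elt hu u = -1 :> twring A hu.
Proof.
apply/eqP; rewrite -addr_eq0 -(tw_pi1 A hu) -tw_piD -(subr0 (_ + _)) tw_piB.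
by rewrite subr_eq0; apply/eqP/tw_piP; exists 1; rewrite subr0 mul1r.
Qed.

Lemma lat_formDr x y z : lat_form x (y + z) = lat_form x y + lat_form x z.
Proof. by rewrite !(lat_formC x) lat_formDl. Qed.

Lemma lat_formN x y : lat_form x (- y) = - lat_form x y.
Proof.
have f0 : lat_form x 0 = 0 by apply: (addrI (lat_form x 0)); rewrite -lat_formDr !addr0.
by apply/eqP; rewrite -addr_eq0 -lat_formDr addNr f0.
Qed.

Let F x y s : twring int hu := tw_elt hu s *~ lat_form x (gact s y).

Let Fu x y s : F x y (s + u) = F x y s.
Proof.
by rewrite /F tw_eltD tw_elt_u gactD gact_u raddfN lat_formN mulrN1 mulNrz mulrNz opprK.
Qed.

Lemma lip_indep S T x y : coset_reps S -> coset_reps T -> lip S x y = lip T x y.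
Proof. by move=> /coset_repsP hS /coset_repsP hT; apply: sum_reps (Fu x y). Qed.

Lemma lip_shift S t x y : coset_reps S ->
  lip S x y = \sum_(s in S) F x y (t + s).
Proof.
move=> /coset_repsP hS.
rewrite /lip -/(F x y) (@sum_reps _ S [set s | s - t \in S] (F x y)) //.
- rewrite (reindex_inj (addrI t)) /=; apply: eq_bigl => s.
  by rewrite inE addrAC subrr add0r.
- by move=> s; rewrite !inE addrAC hS.
Qed.

Lemma lip_gactl S t x y : coset_reps S ->
  lip S (gact t x) y = tw_elt hu t * lip S x y.
Proof.
move=> hS; rewrite (lip_shift t) // /lip mulr_sumr; apply: eq_bigr => s _.
by rewrite /F tw_eltD gactD gact_form mulrzAr.
Qed.

Lemma lip_gactr S t x y : coset_reps S ->
  lip S x (gact (- t) y) = tw_elt hu t * lip S x y.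
Proof.
move=> hS; rewrite (lip_shift t) // /lip mulr_sumr; apply: eq_bigr => s _.
by rewrite /F tw_eltD -gactD addrAC subrr add0r mulrzAr.
Qed.

Lemma lipDl S x x' y : lip S (x + x') y = lip S x y + lip S x' y.
Proof.
by rewrite -big_split; apply: eq_bigr => s _; rewrite lat_formDl mulrzDr.
Qed.

Lemma lipDr S x y y' : lip S x (y + y') = lip S x y + lip S x y'.
Proof.
rewrite -big_split; apply: eq_bigr => s _.
by rewrite gact_add lat_formDr mulrzDr.
Qed.

Lemma tw_piE (A : comNzRingType) (a : grpring A G) :
  tw_pi hu a = \sum_s tw_const hu (a s) * tw_elt hu s.
Proof.
rewrite -[X in tw_pi hu X](_ : \sum_s ([ffun r => a s *+ (r == 0)] : grpring A G) * gr_elt A s = a).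
  by rewrite raddf_sum; apply: eq_bigr => s _; apply: tw_piM.
apply/ffunP => r; rewrite sum_ffunE (bigD1 r) //= gr_mul_elt ffunE subrr eqxx.
by rewrite big1 ?addr0 // => t; rewrite gr_mul_elt ffunE subr_eq0 eq_sym => /negbTE ->.
Qed.

Lemma tw_constz (n : int) : tw_const hu n = n%:~R.
Proof.
have e (m : nat) : tw_const hu (m : int) = m%:R.
  elim: m => [|m IH].
    rewrite -[0%:R](raddf0 (tw_pi (A := int) hu)); congr tw_pi.
    by apply/ffunP => s; rewrite !ffunE mul0rn.
  rewrite -addn1 natrD -IH -(tw_pi1 int hu) -tw_piD; congr tw_pi.
  by apply/ffunP => s; rewrite !ffunE PoszD mulrnDl.
case: n => n; first exact: e.
rewrite NegzE mulrNz -[in RHS]pmulrn -e -raddfN; congr tw_pi.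
by apply/ffunP => s; rewrite !ffunE mulNrn.
Qed.

Lemma tw_piEz (a : grpring int G) : tw_pi hu a = \sum_s tw_elt hu s *~ a s.
Proof.
by rewrite tw_piE; apply: eq_bigr => s _; rewrite tw_constz mulrzl.
Qed.

Lemma lipZl S (a : twring int hu) (x : gmod hu L) y : coset_reps S ->
  lip S (a *: x : gmod hu L) y = a * lip S x y.
Proof.
move=> hS; rewrite -[a]tw_reprK [_ *: x]tw_scale_pi tw_piEz mulr_suml.
have lip0 : lip S 0 y = 0.
  by apply: (addrI (lip S 0 y)); rewrite -lipDl !addr0.
pose f z := lip S z y.
have fB : zmod_morphism f.
  move=> z z'; apply/eqP; rewrite eq_sym subr_eq /f -lipDl subrK //.
pose g : {additive L -> twring int hu} :=
  HB.pack f (GRing.isZmodMorphism.Build _ _ f fB).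
rewrite -[LHS]/(g _) raddf_sum; apply: eq_bigr => s _.
by rewrite raddfMz /= /f lip_gactl // mulrzAl.
Qed.

Lemma lipZr S (a : twring int hu) x (y : gmod hu (glat_bar L)) :
  coset_reps S -> lip S x (a *: y : gmod hu (glat_bar L)) = a * lip S x y.
Proof.
move=> hS; rewrite -[a]tw_reprK [_ *: y]tw_scale_pi tw_piEz mulr_suml.
pose f z := lip S x z.
have fB : zmod_morphism f.
  move=> z z'; apply/eqP; rewrite eq_sym subr_eq /f -lipDr subrK //.
pose g : {additive L -> twring int hu} :=
  HB.pack f (GRing.isZmodMorphism.Build _ _ f fB).
rewrite -[LHS]/(g _) raddf_sum; apply: eq_bigr => s _.
by rewrite raddfMz /= /f lip_gactr // mulrzAl.
Qed.

(* Existence and uniqueness of the map x (x) bar y |-> x . bar y. *)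
Lemma lip_tensor S : coset_reps S ->
  exists2 phi : {linear tensor (gmod hu L) (gmod hu (glat_bar L))
                   -> (twring int hu)^o},
    forall (x : gmod hu L) (y : L), phi (tens x (bar_elt y)) = lip S x y
  & forall psi : {linear tensor (gmod hu L) (gmod hu (glat_bar L))
                    -> (twring int hu)^o},
    (forall (x : gmod hu L) (y : L), psi (tens x (bar_elt y)) = lip S x y) ->
    psi =1 phi.
Proof.
move=> hS.
have [||||phi hphi] := @tensor_lift (twring int hu) (gmod hu L)
  (gmod hu (glat_bar L)) (twring int hu)^o (@lip S L).
- exact: lipDl.
- exact: lipDr.
- by move=> a x y; apply: lipZl.
- by move=> a x y; apply: lipZr.
exists phi => // psi hpsi; apply: tensor_hom_ext => x y.
by rewrite hphi; apply: hpsi.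
Qed.

End LiftedInnerProduct.

Definition frac_ideal (I : set (twring rat hu)) : Prop :=
  [/\ I 0, forall x y, I x -> I y -> I (x + y),
      forall (a : twring int hu) x, I x -> I (tw_ratr a * x),
      exists (k : nat) (g : 'I_k -> twring rat hu), (forall i, I (g i)) /\
        forall x, I x -> exists a : 'I_k -> twring int hu,
          x = \sum_i tw_ratr (a i) * g i
    & forall x, exists (k : nat) (c : 'I_k -> rat) (g : 'I_k -> twring rat hu),
        (forall i, I (g i)) /\ x = \sum_i tw_const hu (c i) * g i].

Definition bar_ideal (I : set (twring rat hu)) : set (twring rat hu) :=
  [set tw_bar x | x in I]%classic.

Definition mul_ideal (I J : set (twring rat hu)) : set (twring rat hu) :=
  [set z | exists (k : nat) (x y : 'I_k -> twring rat hu),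
     [/\ forall i, I (x i), forall i, J (y i) & z = \sum_i x i * y i]]%classic.

Definition principal_ideal (w : twring rat hu) : set (twring rat hu) :=
  [set tw_ratr a * w | a in [set: twring int hu]]%classic.

(* f is a G-isomorphism from L onto L_(I,w), that is onto the group I with G
   acting by multiplication and with inner product t(x * bar y / w). *)
Record Giso_LIw (L : glattice u) (I : set (twring rat hu)) (w : twring rat hu)
    (f : L -> twring rat hu) : Prop := {
  Giso_add : forall x y, f (x + y) = f x + f y;
  Giso_inj : injective f;
  Giso_im : range f = I;
  Giso_act : forall s x, f (gact s x) = tw_elt hu s * f x;
  Giso_form : forall x y,
    (lat_form x y)%:~R = tw_t (f x * tw_bar (f y) / w)
}.

End GLattice.

(* Main.v *)
Require Import Defs.
From HB Require Import structures.
From mathcomp Require Import all_boot all_order all_algebra all_fingroup.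
From mathcomp Require Import generic_quotient ring_quotient.
From mathcomp Require Import boolp classical_sets reals complex.
From mathcomp Require Import ring zify.

(* All four conditions are compared with the following one on the lifted inner
   product: (x . bar y) z = (z . bar y) x for all x, y, z in L, and the values
   x . bar y generate the unit ideal of Z<G>.

   It is implied by (b) and (c) because an isomorphism f : L (x) M -> R over
   any commutative ring satisfies f(x, m) z = f(z, m) x, and unimodularity
   turns the functionals f(-, m) into lifted inner products. It is implied by
   (a) because a generator e of L / m L and unimodularity produce y with
   e . bar y = 1 mod m.

   Conversely, 1 = sum_i x_i . bar y_i makes sum_i x_i (x) bar y_i the inverse
   image of 1 under phi, and represents every functional of L. Since Z<G> / m
   is finite, idempotent powers of the x_i . bar y_i glue the x_i and y_i to e
   and y with e . bar y = 1 mod m, so e generates L / m L. For m = 2 the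
   element e . bar y divides an odd integer, so x |-> x . bar y embeds L in
   Q<G>, with w = y . bar y. *)

Set Implicit Arguments.
Unset Strict Implicit.
Unset Printing Implicit Defensive.

Import Order.TTheory GRing.Theory Num.Theory.
Local Open Scope ring_scope.

(* [gact] alone would refer to group actions from mathcomp. *)
Local Notation gact := Defs.gact.

(** * Invertible pairings over a commutative ring *)

Section Ideal.
Variables (R : comNzRingType) (Z : R -> Prop).
Hypotheses (Z0 : Z 0) (ZD : forall a b, Z a -> Z b -> Z (a + b))
  (ZM : forall a b, Z b -> Z (a * b)).

(** Every term of the binomial expansion in degree k + l contains [a ^+ k] or [b ^+ l]. *)
Lemma radicalD a b : (exists k, Z (a ^+ k)) -> (exists k, Z (b ^+ k)) ->
  exists k, Z ((a + b) ^+ k).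
Proof.
move=> [k ak] [l bl]; exists (k + l)%N; rewrite exprDn.
elim/big_ind: _ => // i _; rewrite -mulr_natl; apply: (ZM).
case: (leqP l i) => il.
  by rewrite -(subnK il) exprD mulrA; apply: (ZM).
rewrite mulrC -(@subnK k (k + l - i)); last by rewrite leq_subRL; lia.
by rewrite exprD mulrA; apply: (ZM).
Qed.

(** Elements with a power in [Z] are closed under sums, and all powers of 1 are 1. Applied to
    annihilators and colon ideals, this turns nilpotence along a partition of unity into
    vanishing. *)
Lemma radical_partition (I : eqType) (r : seq I) (F : I -> R) :
  (forall i, i \in r -> exists k, Z (F i ^+ k)) -> \sum_(i <- r) F i = 1 -> Z 1.
Proof.
move=> nilF sum1.
suff [k] : exists k, Z ((\sum_(i <- r) F i) ^+ k) by rewrite sum1 expr1n.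
rewrite big_seq; elim/big_ind: _ => //; first by exists 1%N.
exact: radicalD.
Qed.

(** In a finite quotient the powers of [a] are eventually periodic, so one of them is idempotent.
    The exponent is kept positive so that this power is a multiple of [a]. *)
Lemma idempotent_power (T : finType) (rho : R -> T) :
  (forall a b, rho a = rho b -> Z (a - b)) ->
  forall a, exists k, Z (a ^+ (k.+1 + k.+1) - a ^+ k.+1).
Proof.
move=> hrho a.
have [i [d [d0 hid]]] : exists i d, (0 < d)%N /\ Z (a ^+ (i + d) - a ^+ i).
  have /injectivePn[i [j ij e]] :
      ~~ injectiveb (fun i : 'I_(#|T|.+1) => rho (a ^+ i)).
    by apply/injectiveP => /leq_card; rewrite card_ord ltnn.
  wlog lt_ij : i j ij e / (i < j)%N.
    move=> W; case: (ltngtP i j) => [|ji|/val_inj/eqP]; first exact: W.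
      by apply: (W j i) => //; rewrite eq_sym.
    by rewrite (negbTE ij).
  exists i, (j - i)%N; rewrite subn_gt0 (subnKC (ltnW lt_ij)); split=> //.
  exact: hrho.
have hl l q : (i <= l)%N -> Z (a ^+ (l + q * d) - a ^+ l).
  move=> il; elim: q => [|q IH]; first by rewrite mul0n addn0 subrr.
  have -> : a ^+ (l + q.+1 * d) - a ^+ l = a ^+ (l - i + q * d) *
      (a ^+ (i + d) - a ^+ i) + (a ^+ (l + q * d) - a ^+ l).
    rewrite mulrBr -!exprD addrA; congr (_ - _).
    rewrite (_ : (l - i + q * d + (i + d) = l + q.+1 * d)%N); last first.
      by rewrite mulSn; lia.
    by rewrite (_ : (l - i + q * d + i = l + q * d)%N) ?subrK //; lia.
  by apply: ZD => //; apply: (ZM).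
(* The exponent [i.+1 * d] is past the preperiod and a multiple of the period, so doubling it
   changes nothing modulo [Z]. *)
exists (i.+1 * d).-1; rewrite prednK ?muln_gt0 //; apply: hl.
by apply: (@leq_trans i.+1) => //; apply: leq_pmulr.
Qed.

End Ideal.

(* The idempotent powers of the values f x_i y_i are orthogonalised one after
   the other, and e is glued from the x_i along them. *)
Lemma pairing_unit_mod (R : comNzRingType) (L M : lmodType R) (f : L -> M -> R)
    (fDl : forall x x' y, f (x + x') y = f x y + f x' y)
    (fDr : forall x y y', f x (y + y') = f x y + f x y')
    (fZl : forall a x y, f (a *: x) y = a * f x y)
    (fZr : forall a x y, f x (a *: y) = a * f x y)
    (Z : R -> Prop) (Z0 : Z 0) (ZD : forall a b, Z a -> Z b -> Z (a + b))
    (ZM : forall a b, Z b -> Z (a * b)) (T : finType) (rho : R -> T)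
    (hrho : forall a b, rho a = rho b -> Z (a - b)) (r : seq (L * M)) :
  \sum_(z <- r) f z.1 z.2 = 1 -> exists e y, Z (f e y - 1).
Proof.
(* Invariant modulo [Z]: [c] is idempotent, equals [f e y], and [1 - c] kills a power of every value
   met so far. *)
have step (s : seq (L * M)) : exists e y c, [/\ Z (f e y - c), Z (c * c - c)
    & forall z, z \in s -> exists k, Z ((1 - c) * f z.1 z.2 ^+ k)].
  elim: s => [|[x y1] s [e [y [c [h1 h2 h3]]]]].
    exists 0, 0, 0; split=> //; last by rewrite mul0r subrr.
    rewrite subr0; have -> : f 0 0 = 0 * f 0 0 by rewrite -fZl scale0r.
    by apply: ZM; have := Z0; rewrite -(mul0r (f 0 0)) -fZl scale0r.
  have [k hk] := idempotent_power Z0 ZD ZM hrho (f x y1).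
  set a := f x y1 in hk; set p := a ^+ k in hk *.
  have ek : a ^+ k.+1 = a * p by rewrite exprS.
  rewrite exprD ek in hk.
  (* The idempotent [a * p] is multiplied by [1 - c] to become orthogonal to [c]; the cross terms of
     [f] then carry the factor [c * (1 - c)], which lies in [Z]. *)
  exists (c *: e + (1 - c) *: x), (c *: y + ((1 - c) * p) *: y1),
    (c + (1 - c) * (a * p)); split.
  - rewrite fDl !fDr !fZl !fZr -/a.
    set A := f e y in h1 *; set B := f e y1; set C := f x y.
    have -> : c * (c * A) + c * ((1 - c) * p * B) +
        ((1 - c) * (c * C) + (1 - c) * ((1 - c) * p * a)) -
        (c + (1 - c) * (a * p)) = (c * c) * (A - c) +
        (c + 1 - p * B - C + p * a) * (c * c - c) by ring.
    by apply: ZD; apply: (ZM).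
  - have -> : (c + (1 - c) * (a * p)) * (c + (1 - c) * (a * p)) -
        (c + (1 - c) * (a * p)) =
        (1 - 2 * (a * p) + (a * p) * (a * p)) * (c * c - c) +
        (1 - c) * ((a * p) * (a * p) - a * p) by ring.
    by apply: ZD; apply: (ZM).
  - move=> z; rewrite inE => /predU1P[->|/h3[l hl]] /=.
      exists k.+1; rewrite -/a ek.
      have -> : (1 - (c + (1 - c) * (a * p))) * (a * p) =
          (c - 1) * (a * p * (a * p) - a * p) by ring.
      exact: (ZM).
    exists l; set q := _ ^+ l in hl *.
    have -> : (1 - (c + (1 - c) * (a * p))) * q = (1 - a * p) * ((1 - c) * q).
      by ring.
    exact: (ZM).
move=> sum1; have [e [y [c [h1 h2 h3]]]] := step r; exists e, y.
(* The colon ideal of all [b] with [(1 - c) * b] in [Z] contains a power of each value, and the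
   values sum to 1. *)
have Zc : Z ((1 - c) * 1).
  apply: (@radical_partition _ (fun b => Z ((1 - c) * b))) _ sum1 => //.
  - by rewrite mulr0.
  - by move=> a b ha hb; rewrite mulrDr; apply: ZD.
  - by move=> a b hb; rewrite mulrCA; apply: (ZM).
have -> : f e y - 1 = (f e y - c) + -1 * ((1 - c) * 1) by ring.
by apply: ZD => //; apply: (ZM).
Qed.

Section InvertibleTensor.
Variables (R : comNzRingType) (L M : lmodType R).
Variable f : {linear tensor L M -> R^o}.
Hypothesis bij_f : bijective f.

Lemma tensor_bij_partition :
  exists r : seq (L * M), \sum_(z <- r) f (tens z.1 z.2) = 1 :> R.
Proof.
have [g fK gK] := bij_f; have [s gs] := tensorE (g 1).
exists [seq (z.1 *: z.2.1, z.2.2) | z <- s]; rewrite big_map -[RHS]gK gs.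
by rewrite linear_sum; apply: eq_bigr => z _; rewrite tensZl.
Qed.

(* Universality of the tensor product gives f x m *: z = f z m *: T x for the
   endomorphism T x = \sum_i f x m_i *: x_i. With D = 1 - T this yields
   f x m ^+ 2 *: D z = 0, and the f x_i m_i sum to 1, so D = 0. *)
Lemma tensor_bij_swap (x z : L) (m : M) :
  (f (tens x m) : R) *: z = (f (tens z m) : R) *: x.
Proof.
have [r r1] := tensor_bij_partition.
pose F a b : R := f (tens a b).
have FDl a a' b : F (a + a') b = F a b + F a' b.
  by rewrite /F tensDl linearD.
have FDr a b b' : F a (b + b') = F a b + F a b'.
  by rewrite /F tensDr linearD.
have FZl c a b : F (c *: a) b = c * F a b by rewrite /F tensZl linearZ.
have FZr c a b : F a (c *: b) = c * F a b by rewrite /F tensZr linearZ.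
(* Both sides have image [F a b] under the injective [f]. *)
have tensE a b : tens a b = F a b *: \sum_(p <- r) tens p.1 p.2.
  apply: (bij_inj bij_f); rewrite linearZ linear_sum /=.
  by rewrite [X in _ *: X]r1; apply/esym; apply: mulr1.
pose T a := \sum_(p <- r) F a p.2 *: p.1.
have swapT a b n : F a n *: b = F b n *: T a.
  have [||||phi hphi] := @tensor_lift R L M L (fun c k => F a k *: c).
  - by move=> c c' k; rewrite scalerDr.
  - by move=> c k k'; rewrite FDr scalerDl.
  - by move=> d c k; rewrite !scalerA mulrC.
  - by move=> d c k; rewrite FZr scalerA.
  rewrite -hphi tensE linearZ linear_sum /=; congr (_ *: _).
  by apply: eq_bigr => p _; rewrite hphi.
have TD a b : T (a + b) = T a + T b.
  by rewrite -big_split; apply: eq_bigr => p _; rewrite FDl scalerDl.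
pose D a := a - T a.
have DD a b : D (a + b) = D a + D b by rewrite /D TD opprD addrACA.
have FD0 a n : F a n *: D a = 0 by rewrite scalerBr swapT subrr.
(* Expanding [FD0] at [a + b] gives [F a n *: D b = - (F b n *: D a)], and [F a n] kills the
   right-hand side. *)
have FD2 a b n : F a n ^+ 2 *: D b = 0.
  have : F (a + b) n *: D (a + b) = 0 by [].
  rewrite DD FDl scalerDl !(scalerDr _ (D a)) !FD0 add0r addr0.
  move/eqP; rewrite addr_eq0 => /eqP e.
  by rewrite expr2 -scalerA e scalerN scalerA mulrC -scalerA FD0 scaler0 oppr0.
have D0 a : D a = 0.
  rewrite -[D a]scale1r.
  apply: (@radical_partition _ (fun c => c *: D a = 0)) _ r1.
  - exact: scale0r.
  - by move=> b c hb hc; rewrite scalerDl hb hc addr0.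
  - by move=> b c hc; rewrite -scalerA hc scaler0.
  - by move=> p _; exists 2%N; apply: FD2.
have Ta : T x = x by apply/esym/eqP; rewrite -subr_eq0; apply/eqP/D0.
by rewrite -/(F x m) swapT Ta.
Qed.

End InvertibleTensor.

(** * Lattices *)

(** The determinant of 1 + X A is a polynomial in X with constant term det 1 = 1. *)
Lemma det_add1_scale (R : comNzRingType) n (m : R) (A : 'M[R]_n) :
  exists q, \det (1%:M + m *: A) = 1 + m * q.
Proof.
pose p : {poly R} := \det (1%:M + 'X *: map_mx polyC A).
have pE a : p.[a] = \det (1%:M + a *: A).
  rewrite -[LHS]/(horner_eval a p) -det_map_mx; congr (\det _).
  apply/matrixP=> i j; rewrite !mxE /= horner_evalE hornerD hornerM hornerX.
  by rewrite hornerC -polyC_natr hornerC.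
have [q [c pq]] : exists q c, p = q * 'X + c%:P.
  elim/poly_ind: (p) => [|q c _]; last by exists q, c.
  by exists 0, 0; rewrite mul0r addr0.
exists q.[m]; rewrite -pE pq hornerMXaddC addrC mulrC; congr (_ + _).
by have := pE 0; rewrite pq hornerMXaddC mulr0 add0r scale0r addr0 det1.
Qed.

(** Determinant trick: writing each generator as an element of [H] plus m times a combination of
    generators gives B z = h with B = 1 mod m, and multiplying by adj B puts every [z l *~ \det B]
    in [H]. *)
Lemma fg_nakayama (V : zmodType) k (z : 'I_k -> V) (H : V -> Prop) (m : int) :
  (forall x, exists c : 'I_k -> int, x = \sum_i z i *~ c i) ->
  H 0 -> (forall x y, H x -> H y -> H (x + y)) ->
  (forall x n, H x -> H (x *~ n)) ->
  (forall x, exists h y, H h /\ x = h + y *~ m) ->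
  exists q : int, forall x, H (x *~ (1 + m * q)).
Proof.
move=> genz H0 HD HZ Hm.
have Hsum (I : finType) (h : I -> V) : (forall i, H (h i)) -> H (\sum_i h i).
  by move=> hH; elim/big_ind: _.
have /choice[h hh] i : exists hc : V * {ffun 'I_k -> int},
    H hc.1 /\ z i = hc.1 + \sum_j z j *~ (m * hc.2 j).
  have [h [y [hh ->]]] := Hm (z i); have [c ->] := genz y.
  exists (h, finfun c); split=> //=; rewrite mulrz_suml; congr (_ + _).
  by apply: eq_bigr => j _; rewrite ffunE -mulrzA mulrC.
pose B : 'M[int]_k := 1%:M + m *: (- \matrix_(i, j) (h i).2 j).
have hB i : (h i).1 = \sum_j z j *~ B i j.
  have -> : (h i).1 = z i - \sum_j z j *~ (m * (h i).2 j).
    by apply/eqP; rewrite eq_sym subr_eq; apply/eqP; case: (hh i).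
  transitivity (\sum_j (z j *~ (i == j)%:R - z j *~ (m * (h i).2 j))).
    rewrite sumrB; congr (_ - _).
    rewrite (bigD1 i) //= eqxx big1 ?addr0 // => j.
    by rewrite eq_sym => /negbTE ->; rewrite mulr0z.
  by apply: eq_bigr => j _; rewrite !mxE -mulrzBr mulrN.
have [q qE] : exists q, \det B = 1 + m * q by apply: det_add1_scale.
exists q => x; rewrite -qE; have [c ->] := genz x; rewrite mulrz_suml.
apply: (Hsum) => l; rewrite -mulrzA mulrC mulrzA; apply: (HZ).
have -> : z l *~ \det B = \sum_i (h i).1 *~ (\adj B) l i.
  transitivity (\sum_j z j *~ ((\adj B) *m B) l j).
    rewrite mul_adj_mx (bigD1 l) //= mxE eqxx mulr1n big1 ?addr0 // => j.
    by rewrite eq_sym => /negbTE jl; rewrite mxE jl.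
  transitivity (\sum_i \sum_j z j *~ ((\adj B) l i * B i j)).
    rewrite exchange_big; apply: eq_bigr => j _.
    by rewrite mxE mulrz_sumr.
  apply: eq_bigr => i _; rewrite hB mulrz_suml; apply: eq_bigr => j _.
  by rewrite -mulrzA mulrC.
by apply: (Hsum) => i; apply: (HZ); case: (hh i).
Qed.

Lemma fg_torsionfree_Zbasis (V : zmodType) k (b : 'I_k -> V) :
  (forall (x : V) (n : int), x *~ n = 0 -> n = 0 \/ x = 0) ->
  (forall x, exists c : 'I_k -> int, x = \sum_i b i *~ c i) ->
  exists l (b' : 'I_l -> V), Zbasis b'.
Proof.
move=> tf; elim: k b => [|k IH] b gen.
  exists 0%N, b => x; have [c xc] := gen x; exists (finfun c); split.
    by rewrite xc !big_ord0.
  by move=> c' _; apply/ffunP => -[].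
case: (pselect (exists c : {ffun 'I_k.+1 -> int},
    c != 0 /\ \sum_i b i *~ c i = 0)) => [[c [c0 bc]]|free]; last first.
  exists k.+1, b => x; have [c xc] := gen x; exists (finfun c); split.
    by rewrite xc; apply: eq_bigr => i _; rewrite ffunE.
  move=> c' xc'; apply: contrapT => /eqP cc'; apply: free.
  exists (finfun c - c'); rewrite subr_eq0; split=> //.
  transitivity (x - x); last exact: subrr.
  rewrite {1}xc {1}xc' -sumrB; apply: eq_bigr => i _.
  by rewrite !ffunE mulrzBr.
(* The Smith form of the single row [c] exhibits it as [g] times the first row of an invertible
   [R]. *)
have [L _ [R Ru [d _ cE]]] := int_Smith_normal_form (\row_i c i).
pose g := L 0 0 * d`_0.
have cg j : c j = g * R 0 j.
  have /matrixP/(_ 0 j) := cE; rewrite !mxE => ->.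
  rewrite (bigD1 0) //= !mxE big_ord1 !mxE eqxx mulr1n big1 ?addr0 // => i i0.
  rewrite !mxE big_ord1 !mxE eq_sym (negbTE i0 : (i == 0 :> nat) = false).
  by rewrite mulr0 mul0r.
pose b1 i := \sum_j b j *~ R i j.
have b10 : b1 0 = 0.
  have /tf[g0|//] : b1 0 *~ g = 0.
    rewrite -bc /b1 mulrz_suml; apply: eq_bigr => j _.
    by rewrite -mulrzA cg mulrC.
  case/eqP: c0; apply/ffunP => j.
  by rewrite cg g0 mul0r ffunE.
apply: (IH (fun i => b1 (lift ord0 i))) => x; have [a ->] := gen x.
exists (fun i => \sum_j a j * invmx R j (lift ord0 i)).
transitivity (\sum_i b1 i *~ (\sum_j a j * invmx R j i)); last first.
  by rewrite big_ord_recl b10 mul0rz add0r.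
have bE j : b j = \sum_i b1 i *~ invmx R j i.
  transitivity (\sum_l b l *~ (invmx R *m R) j l).
    rewrite mulVmx // (bigD1 j) //= mxE eqxx big1 ?addr0 // => l.
    by rewrite eq_sym => /negbTE lj; rewrite mxE lj.
  under eq_bigr do rewrite mxE mulrz_sumr.
  rewrite exchange_big; apply: eq_bigr => i _; rewrite /b1 mulrz_suml.
  by apply: eq_bigr => l _; rewrite -mulrzA mulrC.
under eq_bigr => j _ do rewrite bE mulrz_suml.
rewrite exchange_big; apply: eq_bigr => i _; rewrite mulrz_sumr.
by apply: eq_bigr => j _; rewrite -mulrzA mulrC.
Qed.

Lemma Zbasis_coord (V : zmodType) k (b : 'I_k -> V) : Zbasis b ->
  exists co : {additive V -> 'rV[int]_k},
    [/\ forall x, x = \sum_i b i *~ co x 0 i,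
        forall c : 'rV[int]_k, co (\sum_i b i *~ c 0 i) = c
      & forall i, co (b i) = delta_mx 0 i].
Proof.
move=> hb; have /choice[co hco] x : exists c : 'rV[int]_k,
    x = \sum_i b i *~ c 0 i /\
    forall c' : 'rV[int]_k, x = \sum_i b i *~ c' 0 i -> c = c'.
  have [c [xc uc]] := hb x; exists (\row_i c i); split=> [|c' xc'].
    by rewrite {1}xc; apply: eq_bigr => i _; rewrite mxE.
  apply/rowP => i; rewrite mxE (uc [ffun i => c' 0 i]) ?ffunE //.
  by rewrite {1}xc'; apply: eq_bigr => j _; rewrite ffunE.
have coB : zmod_morphism co.
  move=> x y; case: (hco (x - y)) => _; apply.
  transitivity (\sum_i b i *~ co x 0 i - \sum_i b i *~ co y 0 i).
    by congr (_ - _); [case: (hco x)|case: (hco y)].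
  by rewrite -sumrB; apply: eq_bigr => i _; rewrite !mxE mulrzBr.
pose coA : {additive V -> 'rV[int]_k} :=
  HB.pack co (GRing.isZmodMorphism.Build _ _ co coB).
exists coA; split=> [x|c|i] /=; first by case: (hco x).
  by case: (hco (\sum_i b i *~ c 0 i)) => _ /(_ c); apply.
case: (hco (b i)) => _; apply.
rewrite (bigD1 i) //= mxE !eqxx big1 ?addr0 // => j /negbTE ji.
by rewrite mxE ji.
Qed.

(** Completing the square splits off the pivot [a] and leaves the Schur complement [B'], again
    positive definite. No square roots are taken, so the rationals suffice. *)
Lemma posdef_diag (F : realFieldType) n (A : 'M[F]_n) : A^T = A ->
  (forall v : 'rV_n, v != 0 -> 0 < (v *m A *m v^T) 0 0) ->
  exists (d : 'rV[F]_n) (P : 'M[F]_n),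
    (forall i, 0 < d 0 i) /\ A = P^T *m diag_mx d *m P.
Proof.
elim: n A => [|n IH] A symA posA.
  by exists 0, 0; split=> [[]|] //; apply/matrixP => -[].
rewrite -[n.+1]/(1 + n)%N in A symA posA *.
pose a := A 0 0; pose r : 'rV_n := ursubmx A; pose B : 'M_n := drsubmx A.
have eA : A = block_mx a%:M r r^T B.
  rewrite -[LHS]submxK; congr block_mx.
    by rewrite [LHS]mx11_scalar !mxE; congr (A _ _)%:M; apply/val_inj.
  by rewrite /r trmx_ursub symA.
have a0 : 0 < a.
  have d0 : delta_mx 0 0 != 0 :> 'rV[F]_(1 + n).
    by apply/eqP => /rowP/(_ 0); rewrite !mxE !eqxx => /eqP; rewrite oner_eq0.
  have := posA _ d0; rewrite -rowE trmx_delta -colE.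
  by rewrite !mxE.
pose B' := B - a^-1 *: (r^T *m r).
have BT : B^T = B by rewrite /B trmx_drsub symA.
have symB' : B'^T = B'.
  by rewrite linearB linearZ /= trmx_mul trmxK BT.
have [|d [P [dpos B'E]]] := IH B' symB'.
  (* With this first block, the form of [A] at [v] has the value of the form of [B'] at [w]. *)
  move=> w w0; pose v : 'rV_(1 + n) := row_mx (- a^-1 *: (w *m r^T)) w.
  have v0 : v != 0.
    apply: contraNneq w0 => v0; have := congr1 rsubmx v0.
    by rewrite row_mxKr linear0 => ->.
  have := posA v v0; rewrite eA mul_row_block.
  rewrite -scalemxAl mul_mx_scalar scalerA mulNr mulVf ?gt_eqF //.
  rewrite scaleN1r addNr.
  rewrite tr_row_mx mul_row_col mul0mx add0r.
  suff -> : (- a^-1 *: (w *m r^T)) *m r + w *m B = w *m B' by [].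
  by rewrite mulmxBr -scalemxAl -mulmxA -scalemxAr scaleNr addrC.
exists (row_mx a%:M d), (block_mx 1%:M (a^-1 *: r) 0 P); split.
  move=> i; case: (split_ordP i) => j ->.
    by rewrite row_mxEl mxE ord1 eqxx.
  by rewrite row_mxEr.
rewrite diag_mx_row tr_block_mx !mulmx_block !trmx0 trmx1.
rewrite !(mulmx0, mul0mx, mulmx1, mul1mx, addr0, add0r) -B'E eA.
have -> : diag_mx (a%:M : 'rV_1) = a%:M.
  by apply/matrixP => i j; rewrite !ord1 !mxE.
have -> : (a^-1 *: r)^T = a^-1 *: r^T by rewrite linearZ.
rewrite mul_scalar_mx mul_mx_scalar !scalerA mulfV ?gt_eqF //.
by rewrite !scale1r -scalemxAr /B' addrC subrK.
Qed.

Lemma common_denom (I : finType) (v : I -> rat) :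
  exists (N : int) (c : I -> int), 0 < N /\ forall i, N%:~R * v i = (c i)%:~R.
Proof.
exists (\prod_i denq (v i)).
exists (fun i => \prod_(j | j != i) denq (v j) * numq (v i)).
split=> [|i]; first by apply: prodr_gt0 => i _; apply: denq_gt0.
rewrite (bigD1 i) //= [in RHS]mulrC !rmorphM /= mulrAC; congr (_ * _).
by rewrite mulrC numqE.
Qed.

Section LatticeForm.
Variable L : lattice.
Implicit Types x y : L.

Lemma lat_formMzl x y n : lat_form (x *~ n) y = lat_form x y * n.
Proof.
have fB : zmod_morphism (fun x => lat_form x y).
  by move=> z z' /=; apply/eqP; rewrite eq_sym subr_eq -lat_formDl subrK.
pose f : {additive L -> int} := HB.pack (fun x => lat_form x y)
  (GRing.isZmodMorphism.Build _ _ _ fB).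
by rewrite -[LHS]/(f (x *~ n)) raddfMz /= mulrzz.
Qed.

Lemma lat_form_suml I (r : seq I) (P : pred I) (F : I -> L) y :
  lat_form (\sum_(i <- r | P i) F i) y = \sum_(i <- r | P i) lat_form (F i) y.
Proof.
apply: (big_morph (fun x => lat_form x y)) => [x x'|]; first exact: lat_formDl.
by have := lat_formMzl 0 y 0; rewrite mulr0z mulr0.
Qed.

Lemma lat_formMzr x y n : lat_form x (y *~ n) = lat_form x y * n.
Proof. by rewrite lat_formC lat_formMzl lat_formC. Qed.

Lemma lat_form_sumr I (r : seq I) (P : pred I) (F : I -> L) x :
  lat_form x (\sum_(i <- r | P i) F i) = \sum_(i <- r | P i) lat_form x (F i).
Proof.
rewrite lat_formC lat_form_suml; apply: eq_bigr => i _; exact: lat_formC.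
Qed.

Lemma lat_torsionfree x (n : int) : x *~ n = 0 -> n = 0 \/ x = 0.
Proof.
move=> xn; have [->|x0] := eqVneq x 0; first by right.
left; have := lat_formMzl x x n; rewrite xn -(mulr0z x) lat_formMzl mulr0.
move/esym/eqP; rewrite mulf_eq0 => /orP[/eqP e|/eqP //].
by have := lat_form_gt0 x0; rewrite e ltxx.
Qed.

Lemma lattice_Zbasis : exists k (b : 'I_k -> L), Zbasis b.
Proof.
have [k [b gen]] := lat_fg L.
exact: fg_torsionfree_Zbasis lat_torsionfree gen.
Qed.

(** Positivity on nonzero lattice vectors extends to rational vectors by clearing denominators. *)
Lemma gram_posdef_diag k (b : 'I_k -> L) : Zbasis b ->
  exists (d : 'rV[rat]_k) (P : 'M[rat]_k), (forall i, 0 < d 0 i) /\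
    map_mx intr (gram b) = P^T *m diag_mx d *m P.
Proof.
move=> hb; apply: posdef_diag => [|v v0].
  by apply/matrixP => i j; rewrite !mxE lat_formC.
have [co [_ coK _]] := Zbasis_coord hb.
have [N [c [N0 cE]]] := common_denom (fun i => v 0 i).
pose x : L := \sum_i b i *~ c i.
have x0 : x != 0.
  apply: contraNneq v0 => x0; apply/eqP/rowP => i; rewrite mxE; apply/eqP.
  have : N%:~R * v 0 i = 0.
    rewrite cE; have /rowP/(_ i) : \row_i c i = co x.
      rewrite -[LHS]coK; congr (co _); by apply: eq_bigr => j _; rewrite mxE.
    rewrite mxE => ->; rewrite x0.
    have -> : 0 = \sum_i b i *~ (0 : 'rV[int]_k) 0 i.
      by rewrite big1 // => j _; rewrite mxE.
    by rewrite coK mxE.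
  by move/eqP; rewrite mulf_eq0 intr_eq0 gt_eqF.
have := lat_form_gt0 x0; rewrite -(ltr0z rat).
have -> : (lat_form x x)%:~R =
    N%:~R * N%:~R * (v *m map_mx intr (gram b) *m v^T) 0 0 :> rat.
  rewrite /x lat_form_suml rmorph_sum mxE mulr_sumr /=.
  under eq_bigr => i _ do rewrite lat_form_sumr rmorph_sum /=.
  rewrite exchange_big /=; apply: eq_bigr => j _.
  rewrite !mxE mulr_suml mulr_sumr; apply: eq_bigr => i _.
  rewrite !mxE lat_formMzl lat_formMzr !rmorphM /= -!cE lat_formC.
  by ring.
by rewrite pmulr_rgt0 // mulr_gt0 // ltr0z.
Qed.

Lemma gram_det_gt0 k (b : 'I_k -> L) : Zbasis b -> \det (gram b) != 0 ->
  0 < \det (gram b).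
Proof.
move=> /gram_posdef_diag[d [P [d0 e]]] ne0.
rewrite lt_def ne0 -(ler0z rat) -det_map_mx e !det_mulmx det_tr det_diag.
rewrite mulrAC mulr_ge0 //; first by rewrite -expr2 sqr_ge0.
by apply: prodr_ge0 => i _; apply: ltW.
Qed.

(** In this shape the form extends to a positive semidefinite Hermitian form over the complex
    numbers, as the positivity of psi(w) requires. *)
Lemma lat_form_diag : exists k (d : 'I_k -> rat) (l : 'I_k -> L -> rat),
  (forall i, 0 <= d i) /\
  forall x y, (lat_form x y)%:~R = \sum_i d i * l i x * l i y.
Proof.
have [k [b hb]] := lattice_Zbasis.
have [d [P [d0 e]]] := gram_posdef_diag hb.
have [co [coE _ _]] := Zbasis_coord hb.
pose c x : 'rV[rat]_k := map_mx intr (co x).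
exists k, (fun i => d 0 i), (fun i x => (c x *m P^T) 0 i).
split=> [i|x y]; first exact: ltW.
have -> : (lat_form x y)%:~R =
    (c x *m map_mx intr (gram b) *m (c y)^T) 0 0 :> rat.
  rewrite {1}(coE x) {1}(coE y) lat_form_suml rmorph_sum mxE /=.
  under eq_bigr => i _ do rewrite lat_form_sumr rmorph_sum /=.
  rewrite exchange_big /=; apply: eq_bigr => j _; rewrite !mxE mulr_suml.
  apply: eq_bigr => i _; rewrite !mxE lat_formMzl lat_formMzr !rmorphM /=.
  by ring.
rewrite e !mulmxA -(mulmxA _ P) -[P in P *m (c y)^T]trmxK -trmx_mul mxE.
apply: eq_bigr => i _; rewrite mul_mx_diag !mxE; congr (_ * _).
exact: mulrC.
Qed.

(* The dual basis gives an integral inverse of the Gram matrix, and positive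
   definiteness fixes the sign of its determinant. *)
Lemma unimodularP : unimodular L <->
  forall f : L -> int, (forall x y, f (x + y) = f x + f y) ->
    exists y, forall x, f x = lat_form x y.
Proof.
have fMz (f : L -> int) : (forall x y, f (x + y) = f x + f y) ->
    forall I (r : seq I) (x : I -> L) c,
    f (\sum_(i <- r) x i *~ c i) = \sum_(i <- r) f (x i) * c i.
  move=> fD I r x c; have fB : zmod_morphism f.
    by move=> z z' /=; apply/eqP; rewrite eq_sym subr_eq -fD subrK.
  pose g : {additive L -> int} :=
    HB.pack f (GRing.isZmodMorphism.Build _ _ _ fB).
  rewrite -[LHS]/(g _) raddf_sum; apply: eq_bigr => i _.
  by rewrite raddfMz /= mulrzz.
split=> [[k [b [hb det1]]] f fD|rep].
  (* Since the Gram determinant is 1, [\adj v] is the inverse of [v], and [w] solves the linear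
     system for the coordinates of [y]. *)
  pose v := gram b; pose w : 'cV[int]_k := \adj v *m \col_i f (b i).
  exists (\sum_j b j *~ w j 0) => x; have [co [coE _ _]] := Zbasis_coord hb.
  rewrite (coE x) fMz // lat_form_suml; apply: eq_bigr => i _.
  rewrite lat_formMzl; congr (_ * _); rewrite lat_form_sumr.
  transitivity ((v *m w) i 0).
    by rewrite mulmxA mul_mx_adj [\det v]det1 mul1mx mxE.
  by rewrite mxE; apply: eq_bigr => j _; rewrite lat_formMzr !mxE.
have [k [b hb]] := lattice_Zbasis; exists k, b; split=> //.
have [co [coE _ cob]] := Zbasis_coord hb.
have /choice[y hy] j : exists y, forall x, co x 0 j = lat_form x y.
  by apply: (rep (fun x => co x 0 j)) => x x'; rewrite raddfD mxE.
have e : gram b *m (\matrix_(j, l) co (y j) 0 l)^T = 1%:M.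
  apply/matrixP => i j; rewrite !mxE.
  transitivity (lat_form (b i) (y j)).
    rewrite {1}(coE (y j)) lat_form_sumr; apply: eq_bigr => l _.
    by rewrite !mxE lat_formMzr.
  by rewrite -hy cob mxE eqxx eq_sym.
have := congr1 determinant e; rewrite det_mulmx det1 => de.
have ne0 : \det (gram b) != 0.
  by apply/eqP => d0; move/eqP: de; rewrite d0 mul0r eq_sym oner_eq0.
have := gram_det_gt0 hb ne0.
have : \det (gram b) \is a GRing.unit.
  by apply/unitrP; exists (\det (\matrix_(j, l) co (y j) 0 l)^T); rewrite mulrC.
by rewrite unfold_in /= => /orP[/eqP //|/eqP ->].
Qed.

End LatticeForm.

(** * Twisted group rings and the lifted inner product *)

Section TwistedRing.
Variables (G : finZmodType) (u : G) (hu : #[u]%g = 2%N).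

Section Coefficients.
Variable A : comNzRingType.
Implicit Types x y z : twring A hu.

Lemma tw_t_is_zmod_morphism : zmod_morphism (@tw_t A G u hu).
Proof.
move=> x y; rewrite -[x]tw_reprK -[y]tw_reprK -tw_piB !tw_t_pi !ffunE.
by ring.
Qed.
HB.instance Definition _ := GRing.isZmodMorphism.Build (twring A hu) A
  (@tw_t A G u hu) tw_t_is_zmod_morphism.

Lemma tw_const_is_zmod_morphism : zmod_morphism (@tw_const A G u hu).
Proof.
move=> a b; rewrite -tw_piB; congr tw_pi.
by apply/ffunP => s; rewrite !ffunE mulrnBl.
Qed.

Lemma tw_const_is_monoid_morphism : monoid_morphism (@tw_const A G u hu).
Proof.
split=> [|a b].
  by rewrite -tw_pi1; congr tw_pi; apply/ffunP => s; rewrite !ffunE.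
rewrite -tw_piM; congr tw_pi; apply/ffunP => s.
rewrite gr_mulE (bigD1 0) //= !ffunE eqxx subr0 mulrnAr big1 ?addr0 // => t.
by rewrite !ffunE => /negbTE ->; rewrite mul0r.
Qed.
HB.instance Definition _ := GRing.isZmodMorphism.Build A (twring A hu)
  (@tw_const A G u hu) tw_const_is_zmod_morphism.
HB.instance Definition _ := GRing.isMonoidMorphism.Build A (twring A hu)
  (@tw_const A G u hu) tw_const_is_monoid_morphism.

Lemma tw_bar_is_zmod_morphism : zmod_morphism (@tw_bar A G u hu).
Proof.
move=> x y; rewrite -[x]tw_reprK -[y]tw_reprK -tw_piB !tw_bar_pi gr_barB.
exact: tw_piB.
Qed.

Lemma tw_bar_is_monoid_morphism : monoid_morphism (@tw_bar A G u hu).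
Proof.
split=> [|x y].
  by rewrite -(tw_pi1 A hu) tw_bar_pi -[1]/(gr_elt A 0) gr_bar_elt oppr0.
by rewrite -[x]tw_reprK -[y]tw_reprK -tw_piM !tw_bar_pi gr_barM tw_piM.
Qed.
HB.instance Definition _ := GRing.isZmodMorphism.Build (twring A hu)
  (twring A hu) (@tw_bar A G u hu) tw_bar_is_zmod_morphism.
HB.instance Definition _ := GRing.isMonoidMorphism.Build (twring A hu)
  (twring A hu) (@tw_bar A G u hu) tw_bar_is_monoid_morphism.

Lemma tw_bar_elt s : tw_bar (tw_elt hu s) = tw_elt hu (- s) :> twring A hu.
Proof. by rewrite tw_bar_pi gr_bar_elt. Qed.

Lemma tw_t_bar x : tw_t (tw_bar x) = tw_t x.
Proof.
by rewrite -[x]tw_reprK tw_bar_pi !tw_t_pi !ffunE oppr0 (order2N hu).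
Qed.

Lemma tw_elt0 : tw_elt hu 0 = 1 :> twring A hu.
Proof. exact: tw_pi1. Qed.

Lemma tw_t_elt s : tw_t (tw_elt hu s) = (s == 0)%:R - (s == u)%:R :> A.
Proof. by rewrite tw_t_pi !ffunE ![_ == s]eq_sym. Qed.

Lemma tw_t_shift s (a : grpring A G) :
  tw_t (tw_elt hu (- s) * tw_pi hu a) = a s - a (s + u).
Proof.
by rewrite -tw_piM tw_t_pi mulrC !gr_mul_elt opprK add0r [u + s]addrC.
Qed.

Variable S : {set G}.
Hypothesis hS : coset_reps u S.

(** The relation u = -1 folds the coefficients at [s] and [s + u] into their difference, which is
    what t reads off after translation by [- s]. *)
Lemma tw_coord x : x = \sum_(s in S)
  tw_const hu (tw_t (tw_elt hu (- s) * x)) * tw_elt hu s.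
Proof.
have hS' := coset_repsP hu hS.
rewrite -[in LHS](tw_reprK x) -[in RHS](tw_reprK x); set a := repr x.
under [RHS]eq_bigr do rewrite tw_t_shift raddfB mulrBl.
rewrite tw_piE (bigID [in S]) /= [X in _ + X](reindex_inj (addIr u)) /=.
rewrite sumrB; congr (_ + _); rewrite -sumrN; apply: eq_big => s.
  by rewrite hS' negbK.
by rewrite tw_eltD tw_elt_u mulrN1 mulrN.
Qed.

Lemma tw_t_reps s r : s \in S -> r \in S ->
  tw_t (tw_elt hu (- s) * tw_elt hu r) = (r == s)%:R :> A.
Proof.
move=> sS rS; rewrite -tw_eltD tw_t_elt [- s + r]addrC subr_eq0 subr_eq.
have /negbTE-> : r != u + s; last exact: subr0.
by apply: contraTneq rS => ->; rewrite addrC (coset_repsP hu hS) sS.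
Qed.

(** Identities in the twisted group ring thereby reduce to values of t on translates, which for
    lifted inner products are values of the form. *)
Lemma tw_ext x y :
  (forall s, tw_t (tw_elt hu (- s) * x) = tw_t (tw_elt hu (- s) * y)) -> x = y.
Proof.
move=> h; rewrite (tw_coord x) (tw_coord y).
by apply: eq_bigr => s _; rewrite h.
Qed.

End Coefficients.

Lemma tw_coordz (S : {set G}) (x : twring int hu) : coset_reps u S ->
  x = \sum_(s in S) tw_elt hu s *~ tw_t (tw_elt hu (- s) * x).
Proof.
move=> hS; rewrite [LHS](tw_coord hS); apply: eq_bigr => s _.
by rewrite tw_constz mulrzl.
Qed.

Lemma tw_ratr_is_zmod_morphism : zmod_morphism (@tw_ratr G u hu).
Proof.
move=> x y; rewrite -[x]tw_reprK -[y]tw_reprK -tw_piB !tw_ratr_pi gr_ratrB.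
exact: tw_piB.
Qed.

Lemma tw_ratr_is_monoid_morphism : monoid_morphism (@tw_ratr G u hu).
Proof.
split=> [|x y].
  by rewrite -(tw_pi1 int hu) tw_ratr_pi -[1]/(gr_elt int 0) gr_ratr_elt tw_pi1.
by rewrite -[x]tw_reprK -[y]tw_reprK -tw_piM !tw_ratr_pi gr_ratrM tw_piM.
Qed.
HB.instance Definition _ := GRing.isZmodMorphism.Build (twring int hu)
  (twring rat hu) (@tw_ratr G u hu) tw_ratr_is_zmod_morphism.
HB.instance Definition _ := GRing.isMonoidMorphism.Build (twring int hu)
  (twring rat hu) (@tw_ratr G u hu) tw_ratr_is_monoid_morphism.

Lemma tw_ratr_elt s : tw_ratr (tw_elt hu s) = tw_elt hu s.
Proof. by rewrite tw_ratr_pi gr_ratr_elt. Qed.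

Lemma tw_t_ratr x : tw_t (@tw_ratr G u hu x) = (tw_t x)%:~R.
Proof. by rewrite -[x]tw_reprK tw_ratr_pi !tw_t_pi !ffunE rmorphB. Qed.

Lemma tw_bar_ratr x : tw_bar (@tw_ratr G u hu x) = tw_ratr (tw_bar x).
Proof.
rewrite -[x]tw_reprK tw_bar_pi !tw_ratr_pi tw_bar_pi; congr tw_pi.
by apply/ffunP => s; rewrite !ffunE.
Qed.

Lemma tw_ratr_inj (S : {set G}) : coset_reps u S -> injective (@tw_ratr G u hu).
Proof.
move=> hS x y xy; apply: (tw_ext hS) => s; apply: (@intr_inj rat).
by rewrite -!tw_t_ratr !rmorphM /= xy.
Qed.

Lemma card_coset_reps (S : {set G}) : coset_reps u S -> #|S| = (#|G| %/ 2)%N.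
Proof.
move=> /(coset_repsP hu) hS; rewrite -(cardsC S).
have -> : ~: S = (+%R^~ u) @: S.
  apply/setP => s; rewrite !inE; apply/idP/imsetP => [sS|[t tS ->]].
    exists (s - u); last by rewrite subrK.
    by rewrite (order2N hu) hS.
  by rewrite hS tS.
by rewrite card_imset ?addnn -?muln2 ?mulnK //; apply: addIr.
Qed.

(* The residue of a modulo m is read off the residues of its coefficients. *)
Lemma tw_finite_mod (S : {set G}) (m : nat) : coset_reps u S -> (0 < m)%N ->
  exists (T : finType) (rho : twring int hu -> T),
    forall a b, rho a = rho b -> exists c, a - b = c *+ m.
Proof.
move=> hS m0; pose co (a : twring int hu) s := tw_t (tw_elt hu (- s) * a).
(* As [0 < m], the type ['I_m.-1.+1] has [m] elements; the successor shape is what [inord] needs. *)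
exists {ffun G -> 'I_m.-1.+1}%type,
  (fun a => [ffun s => inord `|(co a s %% m)%Z|%N]) => a b /ffunP ab.
have mz : m%:Z != 0 by rewrite -lt0n.
have dvd s : (m %| co (a - b) s)%Z.
  have := ab s; rewrite !ffunE => /(congr1 val) /=.
  have lt c : (`|(c %% m)%Z| < m.-1.+1)%N.
    by rewrite prednK // -ltz_nat gez0_abs ?modz_ge0 // ltz_pmod.
  rewrite !inordK // => /(congr1 Posz); rewrite !gez0_abs ?modz_ge0 // => e.
  by rewrite -[co _ s]/(tw_t _) mulrBr raddfB -eqz_mod_dvd; apply/eqP.
exists (\sum_(s in S) tw_elt hu s *~ (co (a - b) s %/ m)%Z).
rewrite [LHS](tw_coordz _ hS) -sumrMnl; apply: eq_bigr => s _.
by rewrite -/(co _ _) pmulrn -mulrzA divzK.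
Qed.

End TwistedRing.

Section LiftedProduct.
Variables (G : finZmodType) (u : G) (hu : #[u]%g = 2%N) (S : {set G}).
Hypothesis hS : coset_reps u S.
Variable L : glattice u.
Implicit Types x y : L.

Local Notation lip := (lip hu S).

(** [S] contains exactly one of 0 and [u], and t vanishes on its other elements. If it is [u], the
    sign t(u) = -1 cancels the action of [u] as -1. *)
Lemma tw_t_lip x y : tw_t (lip x y) = lat_form x y.
Proof.
have [s sS su] : exists2 s, s \in S & s = 0 \/ s = u.
  case: (boolP (0 \in S)) => h0; first by exists 0 => //; left.
  exists u; last by right.
  by rewrite -[u]add0r (coset_repsP hu hS).
have h r : r \in S -> r != s -> r != 0 /\ r != u.
  move=> rS rs; suff : r != s + u.
    by move: rs; case: su => ->; rewrite ?add0r ?(order2D hu).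
  by apply: contraTneq rS => ->; rewrite (coset_repsP hu hS) negbK.
rewrite /lip raddf_sum (bigD1 s) //= big1 ?addr0 => [|r /andP[rS rs]];
  last first.
  have [/negbTE r0 /negbTE ru] := h r rS rs.
  by rewrite raddfMz /= tw_t_elt r0 ru subrr mul0rz.
rewrite raddfMz /= tw_t_elt; case: su => ->.
  by rewrite eqxx eq_sym (negbTE (order2_neq0 hu)) subr0 gact0 mulrzz mul1r.
rewrite eqxx (negbTE (order2_neq0 hu)) sub0r gact_u lat_formN mulrzz.
by rewrite mulrNN mul1r.
Qed.

Lemma tw_t_shift_lip s x y :
  tw_t (tw_elt hu (- s) * lip x y) = lat_form x (gact s y).
Proof.
by rewrite -lip_gactl // tw_t_lip -(gact_form s) -gactD subrr gact0.
Qed.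

Lemma tw_bar_lip x y : tw_bar (lip x y) = lip y x.
Proof.
apply: (tw_ext hS) => s; rewrite tw_t_shift_lip lat_formC.
rewrite -tw_bar_elt -rmorphM tw_t_bar -{1}[s]opprK tw_t_shift_lip.
by rewrite -[LHS](gact_form s) -gactD subrr gact0.
Qed.

Lemma scale_elt s (x : gmod hu L) : tw_elt hu s *: x = gact s (x : L).
Proof. by rewrite [LHS]tw_scale_pi gr_scale_elt. Qed.

Lemma scale_coord (a : twring int hu) (x : gmod hu L) :
  a *: x = \sum_(s in S) gact s (x : L) *~ tw_t (tw_elt hu (- s) * a).
Proof.
rewrite {1}(tw_coordz a hS) scaler_suml; apply: eq_bigr => s _.
by rewrite -scalerMzl scale_elt.
Qed.

Lemma scale_lip x y (z : gmod hu L) :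
  lip x y *: z = \sum_(s in S) gact s (z : L) *~ lat_form x (gact s y).
Proof.
rewrite /lip scaler_suml; apply: eq_bigr => s _.
by rewrite -scalerMzl scale_elt.
Qed.

Lemma scale_bar (a : twring int hu) (x : gmod hu (glat_bar L)) :
  a *: x = (tw_bar a *: (x : gmod hu L) : gmod hu L).
Proof.
rewrite -[a]tw_reprK tw_bar_pi [LHS]tw_scale_pi [RHS]tw_scale_pi /gr_scale.
rewrite [RHS](reindex_inj oppr_inj); apply: eq_bigr => s _.
by rewrite ffunE opprK.
Qed.

Lemma lipMz x y (n : int) : lip (x *~ n) y = lip x y *~ n.
Proof.
rewrite /Defs.lip mulrz_suml; apply: eq_bigr => s _.
by rewrite lat_formMzl mulrzA.
Qed.

Lemma lip_suml I (r : seq I) (P : pred I) (F : I -> L) y :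
  lip (\sum_(i <- r | P i) F i) y = \sum_(i <- r | P i) lip (F i) y.
Proof.
apply: (big_morph (fun x => lip x y)) => [x x'|]; first exact: lipDl.
by apply: (addrI (lip 0 y)); rewrite -lipDl !addr0.
Qed.

End LiftedProduct.

(** * Rank-one lifted inner products *)

Section LipInvertible.
Variables (G : finZmodType) (u : G) (hu : #[u]%g = 2%N) (S : {set G}).
Hypothesis hS : coset_reps u S.
Variable L : glattice u.

Local Notation Lmod := (gmod hu L).
Local Notation lip := (lip hu S).

Definition lip_swap := forall (x : Lmod) (y : L) (z : Lmod),
  lip x y *: z = lip z y *: x.

Definition lip_full := exists r : seq (L * L), \sum_(z <- r) lip z.1 z.2 = 1.

(** The ideal of multiples of [b] is everything modulo 2, so by Nakayama it contains an odd integer,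
    in particular a nonzero one. *)
Lemma tw_dvd_odd (a b : twring int hu) : b = 1 + a *+ 2 ->
  exists b' q, b' * b = (1 + 2%:Z * q)%:~R.
Proof.
move=> ba; pose H x := exists c, x = c * b.
have [|||||q hq] := @fg_nakayama (twring int hu) _
    (fun i : 'I_#|S| => tw_elt hu (enum_val i)) H 2%:Z.
- move=> x; exists (fun i => tw_t (tw_elt hu (- enum_val i) * x)).
  by rewrite {1}(tw_coordz x hS) big_enum_val.
- by exists 0; rewrite mul0r.
- by move=> _ _ [c ->] [d ->]; exists (c + d); rewrite mulrDl.
- by move=> _ n [c ->]; exists (c *~ n); rewrite mulrzAl.
- move=> x; exists (x * b), (- (a * x)); split; first by exists x.
  by rewrite ba mulrDr mulr1 mulrnAr [a * x]mulrC mulNrz -pmulrn addrK.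
by have [b' e] := hq 1; exists b', q; rewrite -e.
Qed.

Lemma gmod_torsionfree (x : Lmod) (n : int) : n != 0 -> n%:~R *: x = 0 -> x = 0.
Proof.
move=> n0; rewrite scaler_int => /(@lat_torsionfree L)[e|//].
by rewrite e eqxx in n0.
Qed.

(* For a basis b of L and the matrices E of a |-> a e and C of a section of it
   modulo m, det C * adj E inverts E up to the integer det C * det E, which is
   1 modulo m; composing with t gives a functional, represented by y. *)
Lemma invertible_lip_int (m : nat) : invertible L -> (0 < m)%N ->
  exists (e y : L) (q : int), lip e y = (1 + m%:Z * q)%:~R /\
    forall x : Lmod, exists (a : twring int hu) (z : Lmod),
      x = a *: (e : Lmod) + z *~ m.
Proof.
rewrite /invertible -(card_coset_reps hu hS).
move=> [[b hb] /unimodularP uni he] m0.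
have [e gene] := he m m0.
have gen (x : Lmod) : exists (a : twring int hu) (z : Lmod),
    x = a *: (e : Lmod) + z *~ m.
  have [c [z ->]] := gene x; exists (tw_pi hu (finfun c)), z.
  rewrite [_ *: _]tw_scale_pi; congr (_ + _).
  by apply: eq_bigr => s _; rewrite ffunE.
have [co [coE _ cob]] := Zbasis_coord hb.
pose s (j : 'I_#|S|) := enum_val j.
pose E : 'M[int]_#|S| := \matrix_j co (gact (s j) e).
have aE (a : twring int hu) : (a *: (e : Lmod) : L) =
    \sum_j gact (s j) e *~ tw_t (tw_elt hu (- s j) * a).
  by rewrite (scale_coord hS) big_enum_val.
have /choice[C hC] i : exists Ci : 'rV[int]_#|S| * L,
    b i = \sum_j gact (s j) e *~ Ci.1 0 j + Ci.2 *~ m.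
  have [a [z ->]] := gen (b i).
  exists (\row_j tw_t (tw_elt hu (- s j) * a), z); rewrite [a *: _]aE.
  by congr (_ + _); apply: eq_bigr => j _; rewrite mxE.
pose Cm : 'M[int]_#|S| := \matrix_i (C i).1.
have scz (n : int) (v : 'rV[int]_#|S|) : n *: v = v *~ n.
  by rewrite -scaler_int intz.
have CE : Cm *m E = 1%:M + m%:Z *: (- \matrix_i co (C i).2).
  apply/row_matrixP => i; rewrite row_mul linearD linearZ linearN /= !rowK row1.
  rewrite -cob [in co (b i)]hC raddfD raddfMz /= scalerN scz addrK raddf_sum.
  rewrite mulmx_sum_row; apply: eq_bigr => j _.
  by rewrite rowK raddfMz scz.
have [q qE] : exists q, \det Cm * \det E = 1 + m%:Z * q.
  by rewrite -det_mulmx CE; apply: det_add1_scale.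
pose tv : 'cV[int]_#|S| := \col_j tw_t (tw_elt hu (s j)).
(* An integral form of a e |-> (1 + m q) t(a): [\det Cm *: \adj E] recovers the coefficients of a
   from the coordinates of a e, up to that factor. *)
pose f x : int := (co x *m (\det Cm *: (\adj E *m tv))) 0 0.
have [y hy] : exists y, forall x, f x = lat_form x y.
  by apply: uni => x x'; rewrite /f raddfD mulmxDl mxE.
exists e, y, q; split=> //.
have sy j : lat_form (gact (s j) e) y = (1 + m%:Z * q) * tw_t (tw_elt hu (s j)).
  rewrite -hy /f; have -> : co (gact (s j) e) = row j E by rewrite rowK.
  rewrite -row_mul -scalemxAr mulmxA mul_mx_adj mul_scalar_mx scalerA qE.
  by rewrite !mxE.
apply: (tw_ext hS) => r; rewrite -lip_gactl // tw_t_lip //.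
have -> : gact (- r) e = tw_elt hu (- r) *: (e : Lmod) by rewrite scale_elt.
rewrite aE lat_form_suml.
under eq_bigr => j _ do rewrite lat_formMzl sy -mulrA.
rewrite -mulr_sumr mulrzr raddfMz /= mulrzz mulrC; congr (_ * _).
rewrite [in RHS](tw_coordz (tw_elt hu (- r)) hS) raddf_sum [RHS]big_enum_val.
by apply: eq_bigr => j _; rewrite raddfMz /= mulrzz.
Qed.

(** By Nakayama an odd multiple N L lies in Z<G> e. On Z<G> e the identity is commutativity of Z<G>,
    and N is cleared from both x and z because L is torsion-free. *)
Lemma invertible_lip_swap : invertible L -> lip_swap.
Proof.
move=> inv x y z; have [e [_ [_ [_ gen]]]] := invertible_lip_int inv (ltn0Sn 1).
have [k [g geng]] := lat_fg L.
pose H (v : Lmod) := exists a : twring int hu, v = a *: (e : Lmod).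
have [||||q hq] := @fg_nakayama Lmod k g H 2%:Z geng.
- by exists 0; rewrite scale0r.
- by move=> _ _ [a ->] [c ->]; exists (a + c); rewrite scalerDl.
- by move=> _ n [a ->]; exists (a *~ n); rewrite scalerMzl.
- move=> v; have [a [v' ->]] := gen v.
  by exists (a *: (e : Lmod)), v'; split=> //; exists a.
have N0 : 1 + 2%:Z * q != 0 by lia.
apply/eqP; rewrite -subr_eq0; apply/eqP.
apply: (gmod_torsionfree N0); apply: (gmod_torsionfree N0).
have [[a xa] [c zc]] := (hq x, hq z).
apply/eqP; rewrite scalerA scalerBr subr_eq0; apply/eqP.
set N := (1 + 2%:Z * q) in xa zc *.
have Nlip v v' : N%:~R * lip v y *: v' = lip (N%:~R *: (v : Lmod)) y *: v'.
  by rewrite lipZl.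
rewrite -!scalerA !(scalerA N%:~R (lip _ _)) !Nlip !(scalerA N%:~R (lip _ _)).
rewrite ![N%:~R * _]mulrC -!scalerA !scaler_int xa zc !lipZl // !scalerA.
by congr (_ *: _); ring.
Qed.

(** A first use with m = 2 makes a nonzero integer N a lifted inner product; a second with m = |N|
    gives a value 1 + |N| q', and a multiple of the first corrects it to 1. *)
Lemma invertible_lip_full : invertible L -> lip_full.
Proof.
move=> inv; have [e [y [q [eq _]]]] := invertible_lip_int inv (ltn0Sn 1).
set N := 1 + _ in eq; have N0 : (0 < `|N|)%N by rewrite absz_gt0 /N; lia.
have [e' [y' [q' [eq' _]]]] := invertible_lip_int inv N0.
exists [:: (e', y'); ((- (Num.sg N * q'))%:~R *: (e : Lmod) : L, y)].
rewrite big_cons big_seq1 /= lipZl // eq eq' -intrM -intrD.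
have -> : 1 + `|N|%N%:Z * q' + - (Num.sg N * q') * N = 1; last by [].
by rewrite abszE normrEsg; ring.
Qed.

Hypotheses (swap : lip_swap) (full : lip_full).

(** The vectors [z.1] and the functionals [lip _ z.2] form a dual basis of L over Z<G>. *)
Lemma lip_partition (x : Lmod) (r : seq (L * L)) :
  \sum_(z <- r) lip z.1 z.2 = 1 ->
  x = \sum_(z <- r) lip x z.2 *: (z.1 : Lmod).
Proof.
move=> r1; rewrite -[LHS]scale1r -r1 scaler_suml; apply: eq_bigr => z _.
exact: swap.
Qed.

Lemma lip_unimodular : unimodular L.
Proof.
have [r r1] := full; apply/unimodularP => f fD.
have fB : zmod_morphism f.
  by move=> z z' /=; apply/eqP; rewrite eq_sym subr_eq -fD subrK.
pose g : {additive L -> int} :=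
  HB.pack f (GRing.isZmodMorphism.Build _ _ _ fB).
(* The vector is read off from f(x) = sum f((x . bar z2) z1) = sum <x, s z2> f(s z1). *)
exists (\sum_(z <- r) \sum_(s in S) gact s z.2 *~ f (gact s z.1)) => x.
rewrite [in LHS](lip_partition x r1) -[LHS]/(g _) raddf_sum lat_form_sumr.
apply: eq_bigr => z _; rewrite scale_lip raddf_sum lat_form_sumr.
by apply: eq_bigr => s _; rewrite raddfMz lat_formMzr /= mulrzz mulrC.
Qed.

Lemma lip_tensor_bij :
  exists2 phi : {linear tensor (gmod hu L) (gmod hu (glat_bar L))
                   -> (twring int hu)^o},
    forall (x : gmod hu L) (y : L), phi (tens x (bar_elt hu y)) = lip x y
  & bijective phi.
Proof.
have [phi hphi _] := lip_tensor hu L hS; exists phi => //.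
have [r r1] := full.
pose one := \sum_(z <- r) tens (z.1 : Lmod) (bar_elt hu z.2).
have phi1 : phi one = 1.
  by rewrite linear_sum -[RHS]r1; apply: eq_bigr => z _; rewrite hphi.
exists (fun a => a *: one) => [t|a]; last first.
  by rewrite linearZ /= phi1; apply: mulr1.
have [s ->] := tensorE t.
transitivity (\sum_(z <- s)
    (phi (z.1 *: tens z.2.1 z.2.2) : twring int hu) *: one).
  by rewrite -[RHS]scaler_suml; congr (_ *: _); apply: linear_sum.
apply: eq_bigr => -[a [x y]] _ /=; rewrite linearZ /= hphi -scalerA.
congr (_ *: _); rewrite scaler_sumr [in RHS](lip_partition x r1).
have tens_suml (v : gmod hu (glat_bar L)) (F : L * L -> Lmod) :
    tens (\sum_(z <- r) F z) v = \sum_(z <- r) tens (F z) v.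
  apply: (big_morph (fun x => tens x v)) => [x1 x2|]; first exact: tensDl.
  by have := tensZl 0 (0 : Lmod) v; rewrite !scale0r.
(* The scalar [lip x z.2] moves to the right factor, where it acts on the underlying element of L as
   [lip z.2 x]; the swap identity then exchanges y and [z.2]. *)
rewrite tens_suml; apply: eq_bigr => z _; rewrite -tensZr tensZl -tensZr.
by congr tens; rewrite !scale_bar !tw_bar_lip.
Qed.

Lemma lip_unit_mod (m : nat) : (0 < m)%N ->
  exists (e y : L) (a : twring int hu), lip e y = 1 + a *+ m.
Proof.
move=> m0; have [T [rho hrho]] := tw_finite_mod hu hS m0; have [r r1] := full.
have [|||||||e [y [a e1]]] := @pairing_unit_mod (twring int hu) Lmod
  (gmod hu (glat_bar L)) (@Defs.lip G u hu S L) _ _ _ _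
  (fun a => exists c, a = c *+ m) _ _ _ T rho hrho r r1.
- exact: lipDl.
- exact: lipDr.
- by move=> a x y; apply: lipZl.
- by move=> a x y; apply: lipZr.
- by exists 0; rewrite mul0rn.
- by move=> _ _ [a ->] [c ->]; exists (a + c); rewrite mulrnDl.
- by move=> a _ [c ->]; exists (a * c); rewrite mulrnAr.
by exists e, y, a; rewrite -e1 addrC subrK.
Qed.

Lemma lip_unit_int : exists (e y : L) (b : twring int hu) (N : int),
  N != 0 /\ b * lip e y = N%:~R.
Proof.
have [e [y [a e1]]] := lip_unit_mod (ltn0Sn 1).
have [b [q bq]] := tw_dvd_odd e1.
by exists e, y, b, (1 + 2%:Z * q); split=> //; lia.
Qed.

Lemma lip_invertible : invertible L.
Proof.
split; last first.
- move=> m m0; have [e [y [a eya]]] := lip_unit_mod m0.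
  (* Here x = (e . bar y) x - m a x, and the swap identity turns (e . bar y) x into (x . bar y)
     e. *)
  exists e => x; exists (repr (lip x y)), (- (a *: (x : Lmod))).
  have xE : lip e y *: (x : Lmod) = x + (a *: (x : Lmod)) *+ m.
    by rewrite eya scalerDl scale1r scalerMnl.
  rewrite -[\sum_s _]/(lip x y *: (e : Lmod)) swap xE mulNrn.
  by rewrite addrK.
- exact: lip_unimodular.
have [k [b hb]] := lattice_Zbasis L.
suff <- : k = (#|G| %/ 2)%N by exists b.
rewrite -(card_coset_reps hu hS).
have [co [coE _ cob]] := Zbasis_coord hb.
have [e [y [c [N [N0 cN]]]]] := lip_unit_int.
(* [A] and [B] are the matrices of x |-> x . bar y and of a |-> a c e. Both composites are
   multiplication by [N], which is nonzero, so comparing ranks over the rationals gives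
   [k = #|S|]. *)
pose s (j : 'I_#|S|) := enum_val j.
pose A : 'M[int]_(k, #|S|) :=
  \matrix_(i, j) tw_t (tw_elt hu (- s j) * lip (b i) y).
pose ce : L := c *: (e : Lmod).
pose B : 'M[int]_(#|S|, k) := \matrix_j co (gact (s j) ce).
have AB : A *m B = N%:M.
  apply/row_matrixP => i; rewrite row_mul -scalemx1 linearZ /= row1 -cob.
  rewrite -[N in RHS]intz scaler_int -raddfMz mulmx_sum_row.
  transitivity (co (lip (b i) y *: (ce : Lmod))).
    rewrite (scale_coord hS) raddf_sum [RHS]big_enum_val; apply: eq_bigr => j _.
    by rewrite rowK !mxE raddfMz -scaler_int intz.
  congr (co _); rewrite scalerA mulrC -scalerA swap scalerA cN.
  exact: (scaler_int N (b i : Lmod)).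
have BA : B *m A = N%:M.
  apply/matrixP => j l; rewrite !mxE -[N]mulr1 -mulrnAr.
  transitivity (tw_t (tw_elt hu (- s l) * lip (gact (s j) ce) y)).
    rewrite [X in lip X y]coE lip_suml mulr_sumr raddf_sum.
    apply: eq_bigr => i _; rewrite !mxE lipMz mulrzAr raddfMz /=.
    by rewrite mulrzz mulrC.
  rewrite lip_gactl // (lipZl _ (e : Lmod)) // cN mulrzr mulrzAr raddfMz /=.
  rewrite (@tw_t_reps _ _ hu int S hS) ?enum_valP // mulrzz mulrC.
  by rewrite (inj_eq enum_val_inj).
have rk (n : nat) : \rank (map_mx intr (N%:M : 'M[int]_n) : 'M[rat]_n) = n.
  by rewrite map_scalar_mx -scalemx1 eqmx_scale ?mxrank1 //= intr_eq0.
apply/eqP; rewrite eqn_leq -{1}(rk k) -{2}(rk #|S|) -AB -BA !map_mxM.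
by rewrite !(leq_trans (mxrankM_maxl _ _)) ?rank_leq_col.
Qed.

End LipInvertible.

(** * Tensor inverses and fractional ideals *)

Section Equivalences.
Variables (G : finZmodType) (u : G) (hu : #[u]%g = 2%N) (S : {set G}).
Hypothesis hS : coset_reps u S.
Variable L : glattice u.

Local Notation Lmod := (gmod hu L).
Local Notation lip := (lip hu S).
Local Notation lip_swap := (lip_swap hu S L).
Local Notation lip_full := (lip_full hu S L).

Lemma tensor_bij_lip
    (phi : {linear tensor Lmod (gmod hu (glat_bar L)) -> (twring int hu)^o}) :
  (forall (x : Lmod) (y : L), phi (tens x (bar_elt hu y)) = lip x y) ->
  bijective phi -> lip_swap /\ lip_full.
Proof.
move=> hphi bij; split=> [x y z|].
  by rewrite -(hphi x) -(hphi z); apply: tensor_bij_swap.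
have [r r1] := tensor_bij_partition bij; exists r; rewrite -r1.
by apply: eq_bigr => z _; rewrite -(hphi z.1).
Qed.

Lemma tensor_unimodular_lip (M : lmodType (twring int hu))
    (f : {linear tensor Lmod M -> (twring int hu)^o}) :
  bijective f -> unimodular L -> lip_swap /\ lip_full.
Proof.
move=> bij /unimodularP uni.
have /choice[d hd] m : exists d : L, forall x : Lmod,
    f (tens x m) = lip x d :> twring int hu.
  have [d hd] : exists d : L, forall x : Lmod,
      tw_t (f (tens x m) : twring int hu) = lat_form (x : L) d.
    apply: (uni (fun x : Lmod => tw_t (f (tens x m) : twring int hu))) => x x'.
    by rewrite tensDl linearD raddfD.
  exists d => x; apply: (tw_ext hS) => s; rewrite tw_t_shift_lip //.
  have -> : tw_elt hu (- s) * f (tens x m) =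
      f (tens (gact (- s) (x : L) : Lmod) m).
    by rewrite -(scale_elt (- s) x) tensZl linearZ.
  by rewrite hd -(gact_form s) -gactD subrr gact0.
have [r r1] := tensor_bij_partition bij; split; last first.
  exists [seq (z.1 : L, d z.2) | z <- r]; rewrite big_map -r1.
  by apply: eq_bigr => z _; rewrite -hd.
have sw x m z : (f (tens x m) : twring int hu) *: z =
    (f (tens z m) : twring int hu) *: x by apply: tensor_bij_swap.
have scaleC (a c : twring int hu) (p : Lmod) : a *: (c *: p) = c *: (a *: p).
  by rewrite !scalerA mulrC.
(* For arbitrary y, insert 1 = sum f(v, m). Swapping under f turns both sides into multiples of v,
   with coefficients (f(z, m) x) . bar y and (f(x, m) z) . bar y, equal by another swap. *)
move=> x y z; rewrite -[LHS]scale1r -[RHS]scale1r -r1.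
rewrite [LHS]scaler_suml [RHS]scaler_suml; apply: eq_bigr => -[v m] _ /=.
rewrite !(scaleC (f _ : twring int hu)) (sw v m z) (sw v m x) !scalerA.
congr (_ *: _); rewrite mulrC [RHS]mulrC.
by rewrite -[LHS](lipZl _ _ _ hS) -[RHS](lipZl _ _ _ hS) sw.
Qed.

Lemma lip_hermitian_rank1 (x y z : L) : lip_swap ->
  lip x y * lip y z = lip y y * lip x z.
Proof.
by move=> swap; rewrite -(lipZl _ (y : Lmod) z hS) swap lipZl.
Qed.

(* 2 #|G| psi (y . bar y) is the value at (psi s)_s of the Hermitian extension
   to C^G of the positive semidefinite form (<s y, t y>)_(s, t). *)
Lemma psi_lip_ge0 (R : realType) (psi : {rmorphism twring rat hu -> R[i]})
  (y : L) : 0 <= psi (tw_ratr (lip y y)).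
Proof.
pose chi s := psi (tw_elt hu s).
have chiD s t : chi (s + t) = chi s * chi t by rewrite /chi tw_eltD rmorphM.
have chi0 : chi 0 = 1 by rewrite /chi tw_elt0 rmorph1.
have chiN s : chi (- s) = (chi s)^*.
  have chi1 : chi (- s) * chi s = 1 by rewrite -chiD addNr.
  (* [chi s] is a root of unity because [s] has finite order. *)
  have n1 : `|chi s| = 1.
    have chiX n : chi (s *+ n) = chi s ^+ n.
      by elim: n => [|n IH]; rewrite ?mulr0n // mulrS chiD IH exprS.
    have /eqP : `|chi s| ^+ #[s]%g = 1.
      rewrite -normrX -chiX; have -> : s *+ #[s]%g = 0 by apply: expg_order.
      by rewrite chi0 normr1.
    by rewrite pexpr_eq1 -?lt0n ?order_gt0 // => /eqP.
  have ne0 : chi s != 0 by rewrite -normr_eq0 n1 oner_eq0.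
  by apply: (mulIf ne0); rewrite chi1 mulrC -normCK n1 expr1n.
have [k [d [l [d0 lE]]]] := lat_form_diag L.
pose v i := \sum_t chi t * ratr (l i (gact t y)).
have vv : \sum_i ratr (d i) * (v i * (v i)^*) =
    \sum_s \sum_t chi (t - s) * (lat_form (gact t y) (gact s y))%:~R.
  have e s t : (lat_form (gact t y) (gact s y))%:~R = \sum_i ratr (d i) *
      ratr (l i (gact t y)) * ratr (l i (gact s y)) :> R[i].
    rewrite -[LHS]ratr_int lE rmorph_sum; apply: eq_bigr => i _.
    by rewrite !rmorphM.
  under [RHS]eq_bigr => s _ do under eq_bigr => t _ do rewrite e mulr_sumr.
  under [RHS]eq_bigr => s _ do rewrite exchange_big.
  rewrite [RHS]exchange_big; apply: eq_bigr => i _ /=.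
  rewrite rmorph_sum mulrC mulr_sumr mulr_suml; apply: eq_bigr => s _.
  rewrite mulr_suml mulr_suml; apply: eq_bigr => t _.
  by rewrite rmorphM /= -chiN fmorph_rat chiD; ring.
pose T := \sum_r chi r * (lat_form y (gact r y))%:~R.
(* The summands depend only on t - s because G preserves the form, so each s contributes [T]. *)
have vT : \sum_i ratr (d i) * (v i * (v i)^*) = #|G|%:R * T.
  rewrite vv mulr_natl -sumr_const; apply: eq_bigr => s _.
  rewrite [LHS](reindex_inj (addIr s)) /=; apply: eq_bigr => r _.
  by rewrite addrK addrC gactD gact_form lat_formC.
have T2 : T = 2 * psi (tw_ratr (lip y y)).
  have lipE : psi (tw_ratr (lip y y)) =
      \sum_(s in S) chi s * (lat_form y (gact s y))%:~R.
    rewrite !rmorph_sum; apply: eq_bigr => s _.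
    by rewrite !rmorphMz /= tw_ratr_elt mulrzr.
  rewrite lipE /T (bigID [in S]) /= [X in _ + X](reindex_inj (addIr u)) /=.
  rewrite mulr_natl mulr2n; congr (_ + _); apply: eq_big => s.
    by rewrite (coset_repsP hu hS) negbK.
  move=> _; rewrite chiD gactD gact_u raddfN lat_formN rmorphN /=.
  by rewrite {2}/chi tw_elt_u rmorphN1 mulrN1 mulrNN.
have ge0 : 0 <= #|G|%:R * (2 * psi (tw_ratr (lip y y))).
  rewrite -T2 -vT; apply: sumr_ge0 => i _.
  by rewrite mulr_ge0 ?mul_conjC_ge0 // ler0q.
by move: ge0; rewrite !pmulr_rge0 ?ltr0n //; apply/card_gt0P; exists 0.
Qed.

(** The ideal is the image of F x = x . bar y. The identity F x bar(F x') = w (x . bar x') gives the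
    form on it, and with [lip_full] it gives the product of the ideal with its conjugate. *)
Lemma lip_Giso_LIw (R : realType) : lip_swap -> lip_full ->
  exists (I : set (twring rat hu)) (w : twring rat hu),
    [/\ frac_ideal I, w \is a GRing.unit,
        mul_ideal I (bar_ideal I) = principal_ideal w,
        (forall psi : {rmorphism twring rat hu -> R[i]}, 0 < psi w)
      & exists f : L -> twring rat hu, Giso_LIw I w f].
Proof.
move=> swap full; have [e [y [b [N [N0 bN]]]]] := lip_unit_int hS full.
have NV : N%:~R * tw_const hu (N%:~R^-1 : rat) = 1 :> twring rat hu.
  by rewrite -(rmorph_int (tw_const hu)) -rmorphM mulfV ?intr_eq0 // rmorph1.
pose F (x : L) : twring rat hu := tw_ratr (lip x y).
have FZ (a : twring int hu) (x : Lmod) : F (a *: x : Lmod) = tw_ratr a * F x.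
  by rewrite /F lipZl // rmorphM.
have FD x x' : F (x + x') = F x + F x' by rewrite /F lipDl rmorphD.
have F0 : F 0 = 0 by apply: (addrI (F 0)); rewrite -FD !addr0.
pose w : twring rat hu := tw_ratr (lip y y).
have FF x x' : F x * tw_bar (F x') = w * tw_ratr (lip x x').
  by rewrite tw_bar_ratr -!rmorphM /= tw_bar_lip // lip_hermitian_rank1.
have uw : w \is a GRing.unit.
  apply/unitrP; pose c := tw_const hu (N%:~R^-1 : rat).
  (* From w (e . bar e) = F e bar(F e) and b F e = N, the inverse of w is (e . bar e) b bar(b) /
     N^2. *)
  pose w' := tw_ratr (lip e e) * (tw_ratr b * tw_bar (tw_ratr b)) * (c * c).
  exists w'.
  have eN : tw_ratr b * F e = N%:~R by rewrite -rmorphM bN rmorph_int.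
  have eN' : tw_bar (tw_ratr b) * tw_bar (F e) = N%:~R.
    by rewrite -rmorphM eN rmorph_int.
  have wE : w * w' = 1.
    transitivity ((tw_ratr b * F e * c) *
        (tw_bar (tw_ratr b) * tw_bar (F e) * c)).
      by rewrite /w' !mulrA -FF; ring.
    by rewrite eN eN' NV mulr1.
  by rewrite [_ * w]mulrC wE.
exists (range F), w; split=> //.
- split.
  + by exists 0.
  + by move=> _ _ [x _ <-] [x' _ <-]; exists (x + x') => //; rewrite FD.
  + by move=> a _ [x _ <-]; exists (a *: (x : Lmod)) => //; rewrite FZ.
  + have [k [g gen]] := lat_fg L; exists k, (fun i => F (g i)).
    split=> [i|_ [x _ <-]]; first by exists (g i).
    have [c ->] := gen x; exists (fun i => (c i)%:~R).
    rewrite (big_morph F FD F0); apply: eq_bigr => i _.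
    by rewrite /F lipMz rmorphMz rmorph_int mulrzl.
  (* [F] sends s b e to N s, so dividing by [N] reaches the basis [S] of Q<G>. *)
  + move=> x; pose g s : L := tw_elt hu s *: (b *: (e : Lmod)).
    exists #|S|, (fun i => tw_t (tw_elt hu (- enum_val i) * x) / N%:~R),
      (fun i => F (g (enum_val i))).
    split=> [i|]; first by exists (g (enum_val i)).
    rewrite {1}(tw_coord hS x) big_enum_val; apply: eq_bigr => i _.
    rewrite FZ FZ -[_ * F e]rmorphM bN rmorph_int tw_ratr_elt rmorphM.
    transitivity (tw_const hu (tw_t (tw_elt hu (- enum_val i) * x)) *
      tw_elt hu (enum_val i) * (N%:~R * tw_const hu (N%:~R^-1 : rat))).
      by rewrite NV mulr1.
    by rewrite /=; ring.
- apply/seteqP; split=> [_ [k [x [x' [xI xI' ->]]]]|_ [a _ <-]].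
    have /choice[v hv] i : exists v, F v = x i.
      by have [v _ <-] := xI i; exists v.
    have /choice[v' hv'] i : exists v', tw_bar (F v') = x' i.
      by have [_ [v' _ <-] <-] := xI' i; exists v'.
    exists (\sum_i lip (v i) (v' i)) => //; rewrite rmorph_sum mulr_suml.
    by apply: eq_bigr => i _; rewrite -hv -hv' FF mulrC.
  have [r r1] := full; pose z i := tnth (in_tuple r) i.
  exists (size r), (fun i => F (a *: ((z i).1 : Lmod) : Lmod)),
    (fun i => tw_bar (F (z i).2)); split=> [i|i|].
  + by exists (a *: ((z i).1 : Lmod)).
  + by exists (F (z i).2) => //; exists (z i).2.
  + rewrite -[X in X * w]mulr1 -(rmorph1 (@tw_ratr G u hu)) -r1 big_tnth.
    rewrite rmorph_sum mulr_sumr mulr_suml; apply: eq_bigr => i _.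
    by rewrite FZ -[RHS]mulrA FF; ring.
- move=> psi; rewrite lt_def psi_lip_ge0 // andbT.
  by apply/eqP => psi0; have := rmorph_unit psi uw; rewrite psi0 unitr0.
exists F; split=> //.
(* For v = x - x', N v = b (e . bar y) v = b (v . bar y) e = 0, and L is torsion-free. *)
- move=> x x' /(tw_ratr_inj hS) xx'.
  have xy0 : lip (x - x') y = 0.
    by apply: (addIr (lip x' y)); rewrite -lipDl subrK add0r.
  apply/eqP; rewrite -subr_eq0; apply/eqP.
  apply: (@gmod_torsionfree G u hu L _ N) => //.
  by rewrite -bN -scalerA swap xy0 scale0r scaler0.
- by move=> s x; rewrite /F lip_gactl // rmorphM /= tw_ratr_elt.
- move=> x x'; rewrite FF mulrAC divrr // mul1r tw_t_ratr.
  by rewrite tw_t_lip.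
Qed.

(** Comparing t on translates gives x . bar y = F x bar(F y) / w. The swap identity is then
    commutativity of Q<G>, and fullness comes from w lying in the product of [I] with its
    conjugate. *)
Lemma Giso_LIw_lip (I : set (twring rat hu)) (w : twring rat hu)
    (F : L -> twring rat hu) : w \is a GRing.unit ->
  mul_ideal I (bar_ideal I) = principal_ideal w -> Giso_LIw I w F ->
  lip_swap /\ lip_full.
Proof.
move=> uw IIw [FD Finj Fim Fact Fform].
have FB : zmod_morphism F.
  by move=> z z' /=; apply/eqP; rewrite eq_sym subr_eq -FD subrK.
pose F' : {additive L -> twring rat hu} :=
  HB.pack F (GRing.isZmodMorphism.Build _ _ F FB).
have FZ (a : twring int hu) (x : Lmod) : F (a *: x : Lmod) = tw_ratr a * F x.
  rewrite (scale_coord hS) -[LHS]/(F' _) raddf_sum.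
  rewrite {2}(tw_coordz a hS) rmorph_sum mulr_suml.
  apply: eq_bigr => s _; rewrite raddfMz /= Fact rmorphMz /=.
  by rewrite tw_ratr_elt mulrzAl.
have lipE x y : tw_ratr (lip x y) = F x * tw_bar (F y) / w.
  apply: (tw_ext hS) => s; rewrite -tw_ratr_elt -rmorphM tw_t_ratr.
  rewrite tw_t_shift_lip // Fform Fact rmorphM /= tw_bar_elt -tw_ratr_elt.
  by congr tw_t; ring.
split=> [x y z|].
  by apply: Finj; rewrite !FZ !lipE; ring.
have : principal_ideal w w by exists 1 => //; rewrite rmorph1 mul1r.
rewrite -IIw => -[k [x [y [xI yI wE]]]].
have /choice[x' hx'] i : exists x', F x' = x i.
  by have := xI i; rewrite -Fim => -[x' _ <-]; exists x'.
have /choice[y' hy'] i : exists y', tw_bar (F y') = y i.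
  by have [z] := yI i; rewrite -Fim => -[y' _ <-] <-; exists y'.
exists [seq (x' i, y' i) | i <- enum 'I_k]; rewrite big_map big_enum.
apply: (tw_ratr_inj hS); rewrite rmorph_sum rmorph1 -(divrr uw) {1}wE mulr_suml.
by apply: eq_bigr => i _ /=; rewrite lipE hx' hy'.
Qed.

End Equivalences.

Unset Implicit Arguments.

Theorem theorem11p1 (R : realType) (G : finZmodType) (u : G)
    (hu : #[u]%g = 2%N) (S : {set G}) (hS : coset_reps u S) (L : glattice u) :
  [<-> invertible L;
       exists2 phi : {linear tensor (gmod hu L) (gmod hu (glat_bar L))
                        -> (twring int hu)^o},
         forall (x : gmod hu L) (y : L), phi (tens x (bar_elt hu y)) = lip hu S x y
         & bijective phi;
       (exists (M : lmodType (twring int hu))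
               (f : {linear tensor (gmod hu L) M -> (twring int hu)^o}),
          bijective f)
       /\ unimodular L;
       exists (I : set (twring rat hu)) (w : twring rat hu),
         [/\ frac_ideal I, w \is a GRing.unit,
             mul_ideal I (bar_ideal I) = principal_ideal w,
             (forall psi : {rmorphism twring rat hu -> R[i]}, 0 < psi w)
           & exists f : L -> twring rat hu, Giso_LIw I w f]].
Proof.
tfae.
- move=> inv; apply: (lip_tensor_bij hS).
    exact: invertible_lip_swap.
  exact: invertible_lip_full.
- move=> [phi hphi bij]; split; first by exists (gmod hu (glat_bar L)), phi.
  have [swap full] := tensor_bij_lip hphi bij.
  exact: lip_unimodular swap full.
- move=> [[M [f bij]] uni].
  have [swap full] := tensor_unimodular_lip hS bij uni.
  exact: (lip_Giso_LIw hS R swap full).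
- move=> [I [w [_ uw IIw _ [f iso]]]].
  have [swap full] := Giso_LIw_lip hS uw IIw iso.
  exact: lip_invertible swap full.
Qed.
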